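(* Let $(1\to N_n\to\Gamma_n\to Q_n\to1)_{n\in\mathbb N}$ be a sequence of extensions of finite groups, with uniformly finite generating sets of the $\Gamma_n$, which admits an FCE-by-FCE structure. If $(\Gamma_n)$ is unbounded, then the sequence $(\Gamma_n)_{n\in\mathbb N}$ does not have geometric property (T).
   Context: Each $\Gamma_n$ has a finite symmetric generating set $S_n$ with $\sup_n\#S_n<\infty$ and the left-invariant word metric; $N_n$ has the subspace metric and $Q_n$ the quotient metric. $(\Gamma_n)$ is unbounded if $\sup_n\mathrm{diam}(\Gamma_n)=\infty$. The extension sequence has an FCE-by-FCE structure if both $(N_n)_n$ and $(Q_n)_n$ admit a fibred coarse embedding into Hilbert space. A sequence of finite metric spaces $(Y_n)$ admits a fibred coarse embedding into a Hilbert space $H$ if there exist: a field of Hilbert spaces $(H_y)_{y\in Y_n,n\in\mathbb N}$ (all affinely isometric to $H$); a section $s$ with $s(y)\in H_y$; non-decreasing functions $\rho_\pm:[0,\infty)\to[0,\infty)$ with $\lim_{r\to\infty}\rho_\pm(r)=\infty$; and a non-decreasing sequence $0\le l_0\le l_1\le\cdots$ with $l_n\to\infty$, such that for every $y\in Y_n$ and every $z\in B_{Y_n}(y,l_n)$ there is an affine isometry $t_y(z):H_z\to H$ satisfying: (i) for $z,z'\in B_{Y_n}(y,l_n)$, $\rho_-(d(z,z'))\le\|t_y(z)(s(z))-t_y(z')(s(z'))\|\le\rho_+(d(z,z'))$; (ii) whenever $y,y'\in Y_n$ and $B_{Y_n}(y,l_n)\cap B_{Y_n}(y',l_n)\ne\emptyset$,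 there is an affine isometry $t_{yy'}:H\to H$ with $t_y(z)\circ t_{y'}(z)^{-1}=t_{yy'}$ for all $z\in B_{Y_n}(y,l_n)\cap B_{Y_n}(y',l_n)$. Geometric property (T) of $(\Gamma_n)$ refers to $X=\bigsqcup_n\Gamma_n$, with distance $\infty$ between distinct pieces. An entourage is a subset of $\{(x,y):d(x,y)\le R\}$ for some $R$; $E_0=\{(x,xs):x\in\Gamma_n,s\in S_n,n\in\mathbb N\}$ is the generating entourage (we may take $S_n$ to contain the unit). $\mathbb C_u[X]$ is the algebra of complex matrices $T=(T_{xy})_{x,y\in X}$ with uniformly bounded entries whose support is an entourage; $\ell^\infty(X)$ is the diagonal subalgebra. A partial translation is $V\in\mathbb C_u[X]$ with entries in $\{0,1\}$ and at most one nonzero entry in each row and column, with range $R_V=\{x:\exists y,\,V_{xy}=1\}$. $\|T\|_{\ell^1}=\inf\{\sum_{i=1}^N\|f_i\|_\infty:T=\sum_{i=1}^N f_iV_i,\ f_i\in\ell^\infty(X),\ V_i\text{ partial translations}\}$. A representation on a Hilbert space $K$ is a unital homomorphism $\pi:\mathbb C_u[X]\to\mathcal L(K)$ with $\|\pi(T)\|\le\|T\|_{\ell^1}$; $K^\pi=\{\xi:\pi(V)\xi=\pi(\chi_{R_V})\xi\ \forall V\}$. $X$ has geometric property (T) if for every Hilbert space $K$ and every representation $\pi$ on $K$ there is $c>0$ such that for every $\xi$ with $\|[\xi]\|_{K/K^\pi}=1$ there is a partial translation $V$ with $\mathrm{supp}(V)\subseteq E_0$ and $\|[\pi(V)\xi-\pi(\chi_{R_V})\xi]\|_{K/K^\pi}\ge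 c$. *)

(* Defs.v *)
From HB Require Import structures.
From mathcomp Require Import all_boot all_order all_algebra all_fingroup.
From mathcomp Require Import all_classical all_reals all_analysis.
From mathcomp Require Import complex.

Set Implicit Arguments.
Unset Strict Implicit.
Unset Printing Implicit Defensive.

Import Order.TTheory GRing.Theory Num.Theory.
Import numFieldNormedType.Exports.

Local Open Scope classical_set_scope.
Local Open Scope ring_scope.

HB.mixin Record CompleteNormedModule_isHilbert (R : realType) V
    & CompleteNormedModule R[i] V := {
  hdot : {dot V for Num.conj};
  hdot_normE : forall v : V, `|v| ^+ 2 = hdot v v }.

#[short(type="hilbertType")]
HB.structure Definition Hilbert (R : realType) :=
  { V of CompleteNormedModule R[i] V & CompleteNormedModule_isHilbert R V }.

(* The library norm takes its values in the nonnegative reals of [R[i]];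
   [rnorm] is the same number seen in [R]. *)
Definition rnorm (R : realType) (V : normedModType R[i]) (v : V) : R :=
  complex.Re `|v|.

Definition affine_isometry (R : realType) (V W : hilbertType R) (f : V -> W) :=
  bijective f /\
  exists2 g : {linear V -> W},
    (forall v, `|g v| = `|v|) & (forall v, f v = g v + f 0).

Section Metrics.
Variables (R : realType) (gT : finGroupType).
Implicit Types (S : {set gT}) (g h : gT).

(* [(S ^+ k)%g] is the set of products of [k] elements of [S]. *)
Definition word_length S g : R :=
  inf [set r : R | exists2 k : nat, g \in (S ^+ k)%g & r = k%:R].

Definition word_dist S g h : R := word_length S (g^-1 * h)%g.

End Metrics.

Definition subspace_dist (R : realType) (S T : Type) (i : S -> T)
  (d : T -> T -> R) : S -> S -> R := fun a b => d (i a) (i b).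

Definition quotient_dist (R : realType) (T Q : Type) (p : T -> Q)
    (d : T -> T -> R) (q q' : Q) : R :=
  inf [set r : R | exists x y, [/\ p x = q, p y = q' & r = d x y]].

Definition diam (R : realType) (T : Type) (d : T -> T -> R) : \bar R :=
  ereal_sup [set r | exists x y, r = (d x y)%:E].

Definition unbounded_seq (R : realType) (Y : nat -> Type)
    (d : forall n, Y n -> Y n -> R) : Prop :=
  ereal_sup [set diam (d n) | n in [set: nat]] = +oo%E.

Definition cball (R : realType) (T : Type) (d : T -> T -> R) (x : T) (r : R) :
  set T := [set y | d x y <= r].

(* A function [0, oo) -> [0, oo) is a function on [R] constrained on the
   nonnegative reals only. *)
Definition control_function (R : realType) (rho : R -> R) : Prop :=
  [/\ forall r, 0 <= r -> 0 <= rho r,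
      forall r s, 0 <= r -> r <= s -> rho r <= rho s &
      rho r @[r --> +oo] --> +oo].

(* [t n y z] is only meaningful for [z] in the ball around [y]. As the affine
   isometry [t n y' z] is bijective, the last clause says that
   [t n y z \o (t n y' z)^-1 = tyy']. *)
Definition fibred_coarse_embedding_into (R : realType) (Y : nat -> finType)
    (d : forall n, Y n -> Y n -> R) (H : hilbertType R) : Prop :=
  exists (Hy : forall n, Y n -> hilbertType R)
         (s : forall n (y : Y n), Hy n y)
         (rhom rhop : R -> R) (l : nat -> R)
         (t : forall n (y z : Y n), Hy n z -> H),
  [/\ forall n (y : Y n), exists f : Hy n y -> H, affine_isometry f,
      control_function rhom /\ control_function rhop,
      [/\ 0 <= l 0%N, forall m n, (m <= n)%N -> l m <= l n
        & l n @[n --> \oo] --> +oo],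
      forall n (y z : Y n), cball (d n) y (l n) z -> affine_isometry (t n y z) &
      (forall n (y z z' : Y n),
          cball (d n) y (l n) z -> cball (d n) y (l n) z' ->
          rhom (d n z z') <= rnorm (t n y z (s n z) - t n y z' (s n z'))
            <= rhop (d n z z')) /\
      (forall n (y y' : Y n),
          cball (d n) y (l n) `&` cball (d n) y' (l n) !=set0 ->
          exists2 tyy' : H -> H, affine_isometry tyy' &
          forall z, (cball (d n) y (l n) `&` cball (d n) y' (l n)) z ->
            forall v : Hy n z, t n y z v = tyy' (t n y' z v))].

Definition fibred_coarse_embedding (R : realType) (Y : nat -> finType)
    (d : forall n, Y n -> Y n -> R) : Prop :=
  exists H : hilbertType R, fibred_coarse_embedding_into d H.

Section GeometricT.
Variables (R : realType) (X : choiceType).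
Variable d : X -> X -> \bar R.
Local Notation C := R[i].
Local Notation matX := (X -> X -> C).
Implicit Types (T S V : matX).

Definition msupp T : set (X * X) := [set xy | T xy.1 xy.2 != 0].

Definition is_entourage (E : set (X * X)) : Prop :=
  exists r : R, E `<=` [set xy | (d xy.1 xy.2 <= r%:E)%E].

Definition Cu : set matX :=
  [set T | (exists M : R, forall x y, rnorm (T x y : C^o) <= M)
           /\ is_entourage (msupp T)].

Definition ell_infty : set (X -> C) :=
  [set f | exists M : R, forall x, rnorm (f x : C^o) <= M].

Definition sup_norm (f : X -> C) : R := sup (range (fun x => rnorm (f x : C^o))).

Definition mdiag (f : X -> C) : matX := fun x y => if x == y then f x else 0.
Definition mone : matX := mdiag (fun=> 1).
Definition madd T S : matX := fun x y => T x y + S x y.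
Definition mscale (a : C) T : matX := fun x y => a * T x y.
(* [\sum_(y \in _)] is the sum of a finitely supported family. *)
Definition mmul T S : matX :=
  fun x z => \sum_(y \in [set: X]) (T x y * S y z).

Definition partial_translation V : Prop :=
  [/\ Cu V,
      forall x y, V x y = 0 \/ V x y = 1,
      forall x y y', V x y != 0 -> V x y' != 0 -> y = y' &
      forall x x' y, V x y != 0 -> V x' y != 0 -> x = x'].

Definition mrange V : set X := [set x | exists y, V x y = 1].

Definition chi (A : set X) : matX := mdiag (fun x => (`[< A x >])%:R).

Definition l1_norm T : R :=
  inf [set r : R | exists (N : nat) (f : 'I_N -> X -> C) (V : 'I_N -> matX),
    [/\ forall i, ell_infty (f i),
        forall i, partial_translation (V i),
        forall x y, T x y = \sum_(i < N) f i x * V i x y &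
        r = \sum_(i < N) sup_norm (f i)]].

(* The map [pi] is only constrained on [Cu]. The last clause is the bound
   [‖pi T‖ <= ‖T‖_l1], which also makes [pi T] a bounded operator. *)
Definition representation (K : hilbertType R) (pi : matX -> {linear K -> K}) :
  Prop :=
  [/\ forall v, pi mone v = v,
      forall T S, Cu T -> Cu S -> forall v, pi (madd T S) v = pi T v + pi S v,
      forall a T, Cu T -> forall v, pi (mscale a T) v = a *: pi T v,
      forall T S, Cu T -> Cu S -> forall v, pi (mmul T S) v = pi T (pi S v) &
      forall T, Cu T -> forall v, rnorm (pi T v) <= l1_norm T * rnorm v].

Definition invariant_vectors (K : hilbertType R)
    (pi : matX -> {linear K -> K}) : set K :=
  [set xi | forall V, partial_translation V ->
              pi V xi = pi (chi (mrange V)) xi].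

Definition quotient_norm (K : hilbertType R) (L : set K) (xi : K) : R :=
  inf [set rnorm (xi - eta) | eta in L].

Definition geometric_property_T_for (E0 : set (X * X)) : Prop :=
  forall (K : hilbertType R) (pi : matX -> {linear K -> K}),
    representation pi ->
    exists2 c : R, 0 < c &
    forall xi, quotient_norm (invariant_vectors pi) xi = 1 ->
    exists V, [/\ partial_translation V, msupp V `<=` E0 &
      c <= quotient_norm (invariant_vectors pi)
             (pi V xi - pi (chi (mrange V)) xi)].

End GeometricT.

Section Union.
Variables (R : realType) (G : nat -> finGroupType).
Variable S : forall n, {set G n}.

(* The type of [X] is [{n : nat & G n}]; when the tags agree, [tagged_as x y]
   is the second component of [y] seen in the piece of [x]. *)
Definition union_dist (x y : {n : nat & G n}) : \bar R :=
  if tag x == tag y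
  then (word_dist R (S (tag x)) (tagged x) (tagged_as x y))%:E else +oo%E.

Definition generating_entourage : set ({n : nat & G n} * {n : nat & G n}) :=
  [set xy | exists n (g s : G n), s \in S n /\
     xy = (Tagged G g, Tagged G (g * s)%g)].

Definition geometric_property_T : Prop :=
  geometric_property_T_for union_dist generating_entourage.

End Union.

Definition uniformly_finite_generating (G : nat -> finGroupType)
    (S : forall n, {set G n}) : Prop :=
  [/\ forall n, ((S n)^-1)%g = S n,
      forall n, <<S n>>%g = [set: G n]%SET &
      exists k : nat, forall n, (#|S n| <= k)%N].

Definition group_extension (N G Q : finGroupType)
    (iota : {morphism [set: N]%SET >-> G}) (p : {morphism [set: G]%SET >-> Q}) :
  Prop :=
  [/\ ('injm iota)%g, (iota @* [set: N]%SET = 'ker p)%g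
    & (p @* [set: G]%SET)%g = [set: Q]%SET].

Definition FCE_by_FCE (R : realType) (N G Q : nat -> finGroupType)
    (iota : forall n, {morphism [set: N n]%SET >-> G n})
    (p : forall n, {morphism [set: G n]%SET >-> Q n})
    (S : forall n, {set G n}) : Prop :=
  fibred_coarse_embedding (Y := N)
    (fun n => subspace_dist (iota n) (word_dist R (S n))) /\
  fibred_coarse_embedding (Y := Q)
    (fun n => quotient_dist (p n) (word_dist R (S n))).

(* Main.v *)
Require Import Defs.
From HB Require Import structures.
From mathcomp Require Import all_boot all_order all_algebra all_fingroup.
From mathcomp Require Import all_classical all_reals all_analysis.
From mathcomp Require Import complex ring lra zify.

Set Implicit Arguments.
Unset Strict Implicit.
Unset Printing Implicit Defensive.

Import Order.TTheory GRing.Theory Num.Theory.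
Import numFieldNormedType.Exports.

Local Open Scope classical_set_scope.
Local Open Scope ring_scope.

(* Either the quotients Q_n have unbounded diameter, or they have diameter at
   most D and the N_n are D-dense in the Gamma_n. With f_n the projection onto
   Q_n, resp. a nearest point map onto N_n, and ell_n the quotient length, resp.
   the word length, |d(f_n x, f_n y) - ell_n(x^-1 y)| is bounded and ell_n is
   unbounded; so it suffices to contradict property (T) from a fibred coarse
   embedding of the targets of the f_n.

   Pulling that embedding back gives kernels psi_n on Gamma_n which, on balls of
   radius tending to infinity, are squared distances in a Hilbert space. By
   Schoenberg, phi_k = exp(-psi_n/(k+1)) is positive semidefinite on these
   balls. Along an ultrafilter U on which ell_n is unbounded, the form
     lim_U |Gamma_n|^-1 sum_k sum_z sum_(x,y) a_k(z,x) b_k(z,y)^* phi_k(x,y)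
   on finitely supported sequences of matrices in C_u[X] is positive
   semidefinite, and left multiplication by C_u[X] extends to a representation
   on the Hilbert completion. The identity matrix placed at index k is a unit
   vector which is almost invariant as k grows, because psi_n is bounded on
   generators. Yet there is no nonzero invariant vector: right translations by
   g_n with ell_n(g_n) large fix it, while psi_n(x, y) is large between a ball
   and its translate, so they asymptotically move finite matrices to orthogonal
   ones. *)

(** * Hilbert completion of a positive semidefinite form *)

(** In the definition of property (T) the constant c depends on the representation, so one
    representation for each k would refute nothing. All the kernels phi_k have to act in a single
    representation, which is why its vectors are sequences indexed by k.

    A fibred embedding linearises balls only; no Hilbert space is attached to Gamma_n as a whole.
    The form is shaped so that this suffices: row z of a matrix a stands for the vector sum_x a(z,x)
    e_x in the space with kernel phi_k, and it is paired with row z of the other matrix only.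
    Bounded propagation keeps the row in a ball about z, where a chart exists for almost all n. Left
    multiplication acts on z: a partial translation repeats no row and drops some, so positivity of
    the row forms makes it a contraction, and the l^1 bound follows.

    The g_n need large ell_n(g_n) but word length bounded in n, since otherwise right translation by
    them is not in C_u[X]; they are cut off from longer elements on which ell_n equals the word
    length. Once there are no invariant vectors, the quotient norms in the definition are plain
    norms. *)

(* [psd_fun] is the real part of a sesquilinear form; [psdZ] is its
   compatibility with the complex structure. *)
Record psd_form (R : realType) (E : lmodType R[i]) := PsdForm {
  psd_fun :> E -> E -> R;
  psdC : forall x y, psd_fun x y = psd_fun y x;
  psdDl : forall x x' y, psd_fun (x + x') y = psd_fun x y + psd_fun x' y;
  psdZr : forall (r : R) x y, psd_fun (r%:C%C *: x) y = r * psd_fun x y;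
  psdZ : forall c x y, psd_fun (c *: x) y = psd_fun x (c^*%C *: y);
  psd_ge0 : forall x, 0 <= psd_fun x x }.

Section PsdForm.
Variables (R : realType) (E : lmodType R[i]) (b : psd_form E).
Implicit Types (x y z : E) (a : nat -> E) (F G : E -> R).

Lemma psdDr x y y' : b x (y + y') = b x y + b x y'.
Proof. by rewrite psdC psdDl !(psdC b x). Qed.

Lemma psd0l y : b 0 y = 0.
Proof.
have := psdDl b 0 0 y; rewrite addr0 => /eqP.
by rewrite -subr_eq0 opprD addNKr oppr_eq0 => /eqP.
Qed.

Lemma psdNl x y : b (- x) y = - b x y.
Proof. by apply/eqP; rewrite -subr_eq0 opprK -psdDl addNr psd0l. Qed.

Lemma psdBl x x' y : b (x - x') y = b x y - b x' y.
Proof. by rewrite psdDl psdNl. Qed.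

Lemma psdBr x y y' : b x (y - y') = b x y - b x y'.
Proof. by rewrite psdC psdBl !(psdC b x). Qed.

Lemma psdZrr (r : R) x y : b x (r%:C%C *: y) = r * b x y.
Proof. by rewrite psdC psdZr psdC. Qed.

Definition psd_norm x : R := Num.sqrt (b x x).

Lemma psd_norm_ge0 x : 0 <= psd_norm x.
Proof. exact: sqrtr_ge0. Qed.

Lemma sqr_psd_norm x : psd_norm x ^+ 2 = b x x.
Proof. by rewrite sqr_sqrtr// psd_ge0. Qed.

(** Usual discriminant argument. The form may be degenerate: if [b y y = 0], the quadratic in t is
    affine and nonnegative, which forces [b x y = 0]; otherwise the t chosen gives the value
    [- b x x - 2]. *)
Lemma psd_CauchySchwarz x y : `|b x y| <= psd_norm x * psd_norm y.
Proof.
rewrite -(@ler_pXn2r _ 2)// ?nnegrE ?mulr_ge0 ?psd_norm_ge0//.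
rewrite exprMn !sqr_psd_norm real_normK ?num_real//.
have H t : 0 <= b x x + t * b x y *+ 2 + t ^+ 2 * b y y.
  have := psd_ge0 b (x + t%:C%C *: y).
  rewrite psdDl !psdDr !psdZr !psdZrr (psdC b y x).
  by congr (0 <= _); ring.
have xx := psd_ge0 b x; have yy := psd_ge0 b y.
have [y0|y0] := eqVneq (b y y) 0.
  have [->|xy0] := eqVneq (b x y) 0; first by rewrite expr0n/= mulr_ge0.
  have := H (- ((b x x + 1) / b x y)); rewrite y0 mulr0 addr0 mulNr divfK//.
  lra.
have {}yy : 0 < b y y by rewrite lt_def y0.
have := H (- (b x y / b y y)).
rewrite -(pmulr_rge0 _ yy).
have -> : b y y * (b x x + - (b x y / b y y) * b x y *+ 2 +
    (- (b x y / b y y)) ^+ 2 * b y y)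
  = b x x * b y y - b x y ^+ 2 by field.
by rewrite subr_ge0.
Qed.

Lemma psd_normD x y : psd_norm (x + y) <= psd_norm x + psd_norm y.
Proof.
rewrite -(@ler_pXn2r _ 2)// ?nnegrE ?addr_ge0 ?psd_norm_ge0//.
rewrite sqrrD !sqr_psd_norm psdDl !psdDr (psdC b y x).
have := le_trans (ler_norm _) (psd_CauchySchwarz x y); lra.
Qed.

Lemma psd_normZ c x : psd_norm (c *: x) = complex.Re `|c| * psd_norm x.
Proof.
rewrite /psd_norm psdZ scalerA mulrC -sqr_normc -(RRe_real (normr_real c)).
rewrite -rmorphXn/= psdZrr sqrtrM ?sqr_ge0// sqrtr_sqr ger0_norm//.
by have := normr_ge0 c; rewrite lecE => /andP[].
Qed.

Lemma psd_normN x : psd_norm (- x) = psd_norm x.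
Proof. by rewrite /psd_norm psdNl psdC psdNl opprK. Qed.

Lemma psd_normB x y : psd_norm (x - y) = psd_norm (y - x).
Proof. by rewrite -opprB psd_normN. Qed.

Lemma psd_norm_trans z x y :
  psd_norm (x - y) <= psd_norm (x - z) + psd_norm (z - y).
Proof. by rewrite -[x in X in X <= _](subrK z) -addrA psd_normD. Qed.

Lemma psd_norm_le_trans z x y (e f : R) :
  psd_norm (x - z) <= e -> psd_norm (z - y) <= f -> psd_norm (x - y) <= e + f.
Proof. by move=> xz zy; exact: le_trans (psd_norm_trans z x y) (lerD xz zy). Qed.

Definition psd_cauchy a := forall e : R, 0 < e ->
  exists n0, forall m n, (n0 <= m)%N -> (n0 <= n)%N ->
    psd_norm (a m - a n) <= e.

Definition represents a F :=
  psd_cauchy a /\ (forall x, b (a n) x @[n --> \oo] --> F x).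

Lemma psd_cauchyD a a' : psd_cauchy a -> psd_cauchy a' ->
  psd_cauchy (fun n => a n + a' n).
Proof.
move=> ca ca' e e0; have e2 : 0 < e / 2 by rewrite divr_gt0.
have [n1 h1] := ca _ e2; have [n2 h2] := ca' _ e2.
exists (maxn n1 n2) => m n; rewrite !geq_max => /andP[m1 m2] /andP[k1 k2].
rewrite opprD addrACA (le_trans (psd_normD _ _))// [leRHS]splitr.
by rewrite lerD ?h1 ?h2.
Qed.

Lemma psd_cauchyZ c a : psd_cauchy a -> psd_cauchy (fun n => c *: a n).
Proof.
move=> ca e e0; have c0 : 0 <= complex.Re `|c|.
  by have := normr_ge0 c; rewrite lecE => /andP[].
have M0 : 0 < complex.Re `|c| + 1 by rewrite ltr_pwDr.
have [n0 h0] := ca _ (divr_gt0 e0 M0); exists n0 => m n m0 k0.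
rewrite -scalerBr psd_normZ.
apply: (@le_trans _ _ ((complex.Re `|c| + 1) * (e / (complex.Re `|c| + 1)))).
  apply: ler_pM; rewrite ?psd_norm_ge0// ?lerDl//; exact: h0.
by rewrite mulrC divfK// gt_eqF.
Qed.

Lemma psd_cauchy_bounded a : psd_cauchy a ->
  exists2 M : R, 0 < M & forall n, psd_norm (a n) <= M.
Proof.
move=> /(_ _ ltr01)[n0 h0].
pose S := \sum_(i < n0.+1) psd_norm (a i).
have S0 : 0 <= S by apply: sumr_ge0 => i _; exact: psd_norm_ge0.
have le_S i : (i <= n0)%N -> psd_norm (a i) <= S.
  move=> i0; rewrite /S (bigD1 (Ordinal (i0 : (i < n0.+1)%N)))//= lerDl.
  by apply: sumr_ge0 => j _; exact: psd_norm_ge0.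
exists (S + 1) => [|n]; first by rewrite ltr_pwDr.
have [/ltnW/le_S|n0n] := ltnP n n0; first by move/le_trans; apply; rewrite lerDl.
rewrite -(subrK (a n0) (a n)) (le_trans (psd_normD _ _))// addrC lerD//.
  exact: le_S.
exact: h0.
Qed.

(** A norm-Cauchy sequence converges weakly at a rate uniform on bounded sets: fix n and let m tend
    to infinity in Cauchy-Schwarz for [a n - a m]. *)
Lemma represents_unif a F : represents a F -> forall e : R, 0 < e ->
  exists n0, forall n x, (n0 <= n)%N -> `|b (a n) x - F x| <= e * psd_norm x.
Proof.
move=> [ca cF] e e0; have [n0 h0] := ca _ e0; exists n0 => n x n0n.
have cv : `|b (a n) x - b (a m) x| @[m --> \oo] --> `|b (a n) x - F x|.
  by apply: cvg_norm; apply: cvgB; [exact: cvg_cst|exact: cF].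
rewrite -(cvg_lim _ cv)//; apply: limr_le; first by apply/cvg_ex; eexists; exact: cv.
near=> m; rewrite -psdBl (le_trans (psd_CauchySchwarz _ _))// ler_wpM2r//.
  exact: psd_norm_ge0.
by apply: h0 => //; near: m; exact: nbhs_infty_ge.
Unshelve. all: by end_near. Qed.

(** The uniform estimates for both sequences are evaluated at the vector [a n - a' n] itself, and
    one factor of its norm cancels. *)
Lemma represents_close a a' F : represents a F -> represents a' F ->
  forall e : R, 0 < e ->
  exists n0, forall n, (n0 <= n)%N -> psd_norm (a n - a' n) <= e.
Proof.
move=> ra ra' e e0; have e2 : 0 < e / 2 by rewrite divr_gt0.
have [n1 h1] := represents_unif ra e2; have [n2 h2] := represents_unif ra' e2.
exists (maxn n1 n2) => n; rewrite geq_max => /andP[/h1{}h1 /h2{}h2].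
have [->//|c0] := eqVneq (psd_norm (a n - a' n)) 0; first exact: ltW.
have {}c0 : 0 < psd_norm (a n - a' n) by rewrite lt_def c0 psd_norm_ge0.
rewrite -(ler_pM2r c0) -expr2 sqr_psd_norm psdBl.
have := h1 (a n - a' n); have := h2 (a n - a' n).
set N := psd_norm _; rewrite !ler_norml => /andP[? ?] /andP[? ?]; lra.
Qed.

Lemma psd_cauchy_represents a : psd_cauchy a -> exists F, represents a F.
Proof.
move=> ca; suff H x : cvg (b (a n) x @[n --> \oo]).
  by exists (fun x => lim (b (a n) x @[n --> \oo])); split=> // x; exact: H.
apply/cauchy_cvgP/cauchy_exP => e e0.
have M0 : 0 < psd_norm x + 1 by rewrite ltr_pwDr// psd_norm_ge0.
have [n0 h0] := ca _ (divr_gt0 e0 M0); exists (b (a n0) x).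
change (\forall n \near \oo, ball (b (a n0) x) e (b (a n) x)).
near=> n; rewrite -ball_normE/= -psdBl (le_lt_trans (psd_CauchySchwarz _ _))//.
apply: (@le_lt_trans _ _ (e / (psd_norm x + 1) * psd_norm x)).
  rewrite ler_wpM2r ?psd_norm_ge0// h0//.
  by near: n; exact: nbhs_infty_ge.
by rewrite mulrAC ltr_pdivrMr// ltr_pM2l// ltrDl.
Unshelve. all: by end_near. Qed.

Lemma psd_cauchy_cvg a a' : psd_cauchy a -> psd_cauchy a' ->
  cvg (b (a n) (a' n) @[n --> \oo]).
Proof.
move=> ca ca'; apply/cauchy_cvgP/cauchy_exP => e e0.
have [M M0 aM] := psd_cauchy_bounded ca.
have [M' M'0 aM'] := psd_cauchy_bounded ca'.
have MM : 0 < M + M' + 1 by rewrite addr_gt0 ?addr_gt0.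
have [n1 h1] := ca _ (divr_gt0 e0 MM); have [n2 h2] := ca' _ (divr_gt0 e0 MM).
pose n0 := maxn n1 n2; exists (b (a n0) (a' n0)).
change (\forall n \near \oo, ball (b (a n0) (a' n0)) e (b (a n) (a' n))).
near=> n; rewrite -ball_normE/=.
have n0n : (n0 <= n)%N by near: n; exact: nbhs_infty_ge.
have -> : b (a n0) (a' n0) - b (a n) (a' n) =
  b (a n0 - a n) (a' n0) + b (a n) (a' n0 - a' n).
  by rewrite psdBl psdBr; ring.
rewrite (le_lt_trans (ler_normD _ _))//.
set d := e / (M + M' + 1) in h1 h2.
have d0 : 0 < d by rewrite divr_gt0.
apply: (@le_lt_trans _ _ (d * M' + M * d)).
  apply: lerD; rewrite (le_trans (psd_CauchySchwarz _ _))// ler_pM// ?psd_norm_ge0//.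
    by apply: h1; rewrite ?leq_maxl// (leq_trans _ n0n)// leq_maxl.
  by apply: h2; rewrite ?leq_maxr// (leq_trans _ n0n)// leq_maxr.
have -> : d * M' + M * d = d * (M + M') by ring.
by rewrite /d mulrAC ltr_pdivrMr// ltr_pM2l// ltrDl.
Unshelve. all: by end_near. Qed.

(** The inner product of two functionals is independent of the sequences that represent them. *)
Lemma represents_cvg a a' c c' F G : represents a F -> represents a' F ->
  represents c G -> represents c' G -> forall l : R,
  b (a n) (c n) @[n --> \oo] --> l -> b (a' n) (c' n) @[n --> \oo] --> l.
Proof.
move=> ra ra' rc rc' l al.
rewrite (_ : (fun n => b (a' n) (c' n)) =
  (fun n => b (a n) (c n) - (b (a n - a' n) (c n) + b (a' n) (c n - c' n)))); last first.
  by apply/funext => n; rewrite psdBl psdBr; ring.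
rewrite -[l]subr0; apply: cvgB => //.
apply/cvgrPdist_le => e e0.
have [M M0 aM] := psd_cauchy_bounded ra'.1.
have [M' M'0 aM'] := psd_cauchy_bounded rc.1.
have MM : 0 < M + M' by rewrite addr_gt0.
have [n1 h1] := represents_close ra ra' (divr_gt0 e0 MM).
have [n2 h2] := represents_close rc rc' (divr_gt0 e0 MM).
near=> n; rewrite sub0r normrN (le_trans (ler_normD _ _))//.
set d := e / (M + M') in h1 h2.
have d0 : 0 < d by rewrite divr_gt0.
apply: (@le_trans _ _ (d * M' + M * d)).
  apply: lerD; rewrite (le_trans (psd_CauchySchwarz _ _))// ler_pM// ?psd_norm_ge0//.
    by apply: h1; near: n; exact: nbhs_infty_ge.
  by apply: h2; near: n; exact: nbhs_infty_ge.
have -> : d * M' + M * d = d * (M + M') by ring.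
by rewrite /d divfK// gt_eqF.
Unshelve. all: by end_near. Qed.

(** The complex form recovered from its real part: it is conjugate linear in the second variable, so
    Re <x, iy> = Im <x, y>. *)
Definition psd_dot x y : R[i] := (b x y +i* b x ('i%C *: y))%C.

Lemma psdI x y : b ('i%C *: x) y = - b x ('i%C *: y).
Proof.
rewrite psdZ (_ : ('i%C)^*%C = - 'i%C :> R[i]) ?scaleNr; last by simpc.
by rewrite psdC psdNl psdC.
Qed.

Lemma psdZE (c : R[i]) x y :
  b (c *: x) y = complex.Re c * b x y - complex.Im c * b x ('i%C *: y).
Proof.
case: c => p q; have -> : (p +i* q)%C = p%:C%C + q%:C%C * 'i%C by simpc.
rewrite scalerDl psdDl psdZr -scalerA psdZr psdI mulrN.
by rewrite /= !(mul0r, mulr0, mulr1, subr0, addr0, add0r).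
Qed.

Fact psd_dot_hermitian x y :
  psd_dot x y = (-1) ^+ false * Num.conj (psd_dot y x).
Proof.
rewrite expr0 mul1r /psd_dot.
apply/eqP; rewrite eq_complex/= psdC eqxx/=.
by rewrite psdC psdI.
Qed.

Lemma psd_dot_linl y : linear_for *%R (psd_dot^~ y).
Proof.
move=> c x x'; apply/eqP; rewrite eq_complex/= !psdDl !psdZE.
case: c => p q /=; rewrite scalerA (_ : 'i%C * 'i%C = -1 :> R[i]); last by simpc.
rewrite scaleN1r (psdC _ x (- y)) psdNl (psdC _ y x).
by apply/andP; split; apply/eqP; ring.
Qed.

Fact psd_dot_bilinear : bilinear_for *%R (Num.conj \; *%R) psd_dot.
Proof.
split=> [y|x]; first exact: psd_dot_linl.
move=> c y y'; rewrite !(psd_dot_hermitian x) !expr0 !mul1r.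
by rewrite psd_dot_linl rmorphD rmorphM.
Qed.

Lemma psd_dotxx x : psd_dot x x = (b x x)%:C%C.
Proof.
apply/eqP; rewrite eq_complex/= eqxx/=.
by have := psdI x x; rewrite psdC => ?; apply/eqP; lra.
Qed.

End PsdForm.

(** * The completion as a Hilbert space of functionals *)

Section Completion.
Variables (R : realType) (E : lmodType R[i]) (b : psd_form E).

(* A vector u of the completion is the real functional x |-> Re <u, x>, which
   avoids quotienting Cauchy sequences; accordingly (c u)(x) = u(c^* x). *)
Definition representable : {pred E -> R} :=
  fun F => `[< exists a, represents b a F >].

Lemma representsB a a' F G : represents b a F -> represents b a' G ->
  represents b (fun n => a n - a' n) (F - G).
Proof.
move=> [ca aF] [ca' aG]; split=> [|x].
  rewrite (_ : (fun n => _) = fun n => a n + (-1) *: a' n).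
    by apply: psd_cauchyD => //; exact: psd_cauchyZ.
  by apply/funext => n; rewrite scaleN1r.
under eq_fun do rewrite psdBl.
by apply: cvgB.
Qed.

Lemma representsD a a' F G : represents b a F -> represents b a' G ->
  represents b (fun n => a n + a' n) (F + G).
Proof.
move=> [ca aF] [ca' aG]; split=> [|x]; first exact: psd_cauchyD.
under eq_fun do rewrite psdDl.
by apply: cvgD.
Qed.

Lemma representsZ c a F : represents b a F ->
  represents b (fun n => c *: a n) (fun x => F (c^*%C *: x)).
Proof.
move=> [ca aF]; split=> [|x]; first exact: psd_cauchyZ.
under eq_fun do rewrite psdZ.
exact: aF.
Qed.

Lemma represents_cst y : represents b (fun=> y) (b y).
Proof.
split=> [e e0|x]; last exact: cvg_cst.
by exists 0%N => m n _ _; rewrite subrr /psd_norm psd0l sqrtr0 ltW.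
Qed.

Lemma representable_zmod : zmod_closed representable.
Proof.
split=> [|F G /asboolP[a aF] /asboolP[a' aG]]; apply/asboolP.
  exists (fun=> 0); rewrite (_ : 0 = b 0); first exact: represents_cst.
  by apply/funext => x; rewrite psd0l.
by exists (fun n => a n - a' n); exact: representsB.
Qed.

HB.instance Definition _ :=
  GRing.isZmodClosed.Build (E -> R) representable representable_zmod.

Record completion := Completion {
  cfun :> E -> R;
  cfunP : cfun \in representable }.

HB.instance Definition _ := [isSub for cfun].
HB.instance Definition _ := [Choice of completion by <:].
HB.instance Definition _ := [SubChoice_isSubZmodule of completion by <:].

Implicit Types (u v w : completion).

Lemma completion_ext u v : (forall x, u x = v x) -> u = v.
Proof. by move=> uv; apply/val_inj/funext. Qed.

Definition crep u : nat -> E := projT1 (cid (asboolP _ (cfunP u))).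

Lemma crepP u : represents b (crep u) u.
Proof. by rewrite /crep; case: cid. Qed.

Lemma cfunDE u v x : (u + v) x = u x + v x. Proof. by []. Qed.

Lemma cfunD u x y : u (x + y) = u x + u y.
Proof.
have [_ h] := crepP u; apply: (cvg_unique _ (h (x + y))) => //.
by rewrite /=; under eq_fun do rewrite psdDr; apply: cvgD.
Qed.

Lemma cscale_subproof (c : R[i]) u : (fun x => u (c^*%C *: x)) \in representable.
Proof.
by apply/asboolP; exists (fun n => c *: crep u n); exact/representsZ/crepP.
Qed.
Definition cscale c u := Completion (cscale_subproof c u).

Lemma cscaleE c u x : cscale c u x = u (c^*%C *: x). Proof. by []. Qed.

Fact cscaleA c d u : cscale c (cscale d u) = cscale (c * d) u.
Proof. by apply: completion_ext => x; rewrite !cscaleE scalerA rmorphM mulrC. Qed.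
Fact cscale1 : left_id 1 cscale.
Proof. by move=> u; apply: completion_ext => x; rewrite cscaleE conjc1 scale1r. Qed.
Fact cscaleDr : right_distributive cscale +%R.
Proof. by move=> c u v; apply: completion_ext. Qed.
Fact cscaleDl u : {morph cscale^~ u : c d / c + d}.
Proof.
move=> c d; apply: completion_ext => x.
by rewrite cfunDE !cscaleE rmorphD scalerDl cfunD.
Qed.

HB.instance Definition _ := GRing.Zmodule_isLmodule.Build R[i] completion
  cscaleA cscale1 cscaleDr cscaleDl.

Definition cdot_re u v : R := lim (b (crep u n) (crep v n) @[n --> \oo]).

Lemma cdot_reP u v a c : represents b a u -> represents b c v ->
  b (a n) (c n) @[n --> \oo] --> cdot_re u v.
Proof.
move=> au cv; apply: (represents_cvg (crepP u) au (crepP v) cv).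
by apply: psd_cauchy_cvg; [case: (crepP u)|case: (crepP v)].
Qed.

Lemma cdot_reE u v a c l : represents b a u -> represents b c v ->
  b (a n) (c n) @[n --> \oo] --> l -> cdot_re u v = l.
Proof. by move=> au cv; apply: cvg_unique => //; exact: cdot_reP. Qed.

Lemma cdot_reC u v : cdot_re u v = cdot_re v u.
Proof.
apply: (cdot_reE (crepP u) (crepP v)).
under eq_fun do rewrite psdC.
exact: (cdot_reP (crepP v) (crepP u)).
Qed.

Lemma cdot_reDl u u' v : cdot_re (u + u') v = cdot_re u v + cdot_re u' v.
Proof.
have uu' : represents b _ (u + u') := representsD (crepP u) (crepP u').
apply: (cdot_reE uu' (crepP v)).
under eq_fun do rewrite psdDl.
by apply: cvgD; exact: cdot_reP (crepP _) (crepP _).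
Qed.

Lemma cdot_reZ c u v : cdot_re (c *: u) v = cdot_re u (c^*%C *: v).
Proof.
have cu : represents b _ (c *: u) := representsZ c (crepP u).
have cv : represents b _ (c^*%C *: v) := representsZ c^*%C (crepP v).
apply: (cdot_reE cu (crepP v)).
under eq_fun do rewrite psdZ.
exact: cdot_reP (crepP u) cv.
Qed.

Lemma cdot_reZr (r : R) u v : cdot_re (r%:C%C *: u) v = r * cdot_re u v.
Proof.
have ru : represents b _ (r%:C%C *: u) := representsZ r%:C%C (crepP u).
apply: (cdot_reE ru (crepP v)).
under eq_fun do rewrite psdZr.
by apply: cvgMr; exact: cdot_reP (crepP _) (crepP _).
Qed.

Lemma cdot_re_ge0 u : 0 <= cdot_re u u.
Proof.
have h := cdot_reP (crepP u) (crepP u); rewrite -(cvg_lim _ h)//.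
apply: limr_ge; first by apply/cvg_ex; eexists; exact: h.
by apply: nearW => n; exact: psd_ge0.
Qed.

(** Definiteness comes from coding vectors as functionals: in the limit, Cauchy-Schwarz against a
    fixed x bounds |u x| by 0. *)
Lemma cdot_re_eq0 u : cdot_re u u = 0 -> u = 0.
Proof.
move=> u0; apply: completion_ext => x; apply/eqP; rewrite -normr_le0.
have [_ /(_ x) h0] := crepP u.
have h' : `|b (crep u n) x| @[n --> \oo] --> `|u x| by exact: cvg_norm.
have h := cdot_reP (crepP u) (crepP u); rewrite u0 in h.
have {}h : psd_norm b (crep u n) * psd_norm b x @[n --> \oo] --> 0.
  rewrite -(mul0r (psd_norm b x)) -(@sqrtr0 R); apply: cvgMl.
  by apply: continuous_cvg => //; exact: sqrt_continuous.
rewrite -(cvg_lim _ h) // -(cvg_lim _ h')//.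
apply: ler_lim; do ?by apply/cvg_ex; eexists; eauto.
by apply: nearW => n; exact: psd_CauchySchwarz.
Qed.

Definition cform := PsdForm cdot_reC cdot_reDl cdot_reZr cdot_reZ cdot_re_ge0.

Definition cnorm u : R[i] := (psd_norm cform u)%:C%C.

Fact cnormD u v : cnorm (u + v) <= cnorm u + cnorm v.
Proof. by rewrite /cnorm -rmorphD/= lecR psd_normD. Qed.
Fact cnormZ c u : cnorm (c *: u) = `|c| * cnorm u.
Proof.
by rewrite /cnorm psd_normZ rmorphM; congr (_ * _).
Qed.
Fact cnorm0_eq0 u : cnorm u = 0 -> u = 0.
Proof.
move=> [/eqP]; rewrite sqrtr_eq0 => u0; apply: cdot_re_eq0.
by apply/le_anti; rewrite u0 cdot_re_ge0.
Qed.

HB.instance Definition _ := Lmodule_isNormed.Build R[i] completion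
  cnormD cnormZ cnorm0_eq0.

Lemma completion_normE u : `|u| = (psd_norm cform u)%:C%C. Proof. by []. Qed.

HB.instance Definition _ := bilinear_isBilinear.Build R[i] completion completion
  R[i] *%R (Num.conj \; *%R) (psd_dot cform) (psd_dot_bilinear cform).
HB.instance Definition _ := isHermitianSesquilinear.Build R[i] completion
  false Num.conj (psd_dot cform) (psd_dot_hermitian cform).

Fact cdot_gt0 u : u != 0 -> 0 < psd_dot cform u u.
Proof.
move=> u0; rewrite psd_dotxx ltcR lt_def cdot_re_ge0 andbT.
by apply: contra_neq u0; exact: cdot_re_eq0.
Qed.

HB.instance Definition _ :=
  isDotProduct.Build R[i] completion (psd_dot cform) cdot_gt0.

Lemma cincl_subproof x : b x \in representable.
Proof. by apply/asboolP; exists (fun=> x); exact: represents_cst. Qed.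
Definition cincl x : completion := Completion (cincl_subproof x).

Lemma cincl_is_linear : linear cincl.
Proof.
move=> c x y; apply: completion_ext => z.
by rewrite cfunDE cscaleE/= psdDl psdZ.
Qed.

HB.instance Definition _ := GRing.isLinear.Build R[i] E completion *:%R cincl
  cincl_is_linear.

Lemma cdot_cincl x y : cform (cincl x) (cincl y) = b x y.
Proof.
have hx : represents b _ (cincl x) := represents_cst x.
have hy : represents b _ (cincl y) := represents_cst y.
by apply: (cdot_reE hx hy); exact: cvg_cst.
Qed.

Lemma psd_norm_cincl x : psd_norm cform (cincl x) = psd_norm b x.
Proof. by rewrite /psd_norm cdot_cincl. Qed.

Lemma cincl_cvg u a : represents b a u -> forall e : R, 0 < e ->
  exists n0, forall n, (n0 <= n)%N -> psd_norm cform (u - cincl (a n)) <= e.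
Proof.
move=> au e e0; have [ca _] := au; have [n0 h0] := ca _ e0; exists n0 => n n0n.
rewrite -(@ler_pXn2r _ 2)// ?nnegrE ?psd_norm_ge0 ?(ltW e0)// sqr_psd_norm.
have h : represents b _ (u - cincl (a n)) := 
  representsB au (represents_cst (a n)).
have {}h := cdot_reP h h; rewrite -[X in X <= _](cvg_lim _ h)//.
apply: limr_le; first by apply/cvg_ex; eexists; exact: h.
near=> m; rewrite -sqr_psd_norm ler_pXn2r// ?nnegrE ?psd_norm_ge0 ?(ltW e0)//.
by apply: h0 => //; near: m; exact: nbhs_infty_ge.
Unshelve. all: by end_near. Qed.

Local Opaque psd_norm cdot_re.

(** The filter contains balls of radius [d n] about centres [u n]. Each centre is replaced by some
    [a n] in E at distance at most [d n], which gives a Cauchy sequence in E; its functional is the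
    limit. Two such steps and the distance from [u m] to [u n] add up to four errors, whence e /
    4. *)
Lemma completion_complete (F : set_system completion) :
  ProperFilter F -> cauchy F -> cvg F.
Proof.
move=> FF /cauchyP cF.
have [d d_gt0 d_small] : exists2 d : nat -> R, (forall n, 0 < d n) &
    forall e : R, 0 < e -> exists n0, forall n, (n0 <= n)%N -> d n <= e.
  exists (fun n => n.+1%:R^-1) => [n|e e0]; first by rewrite invr_gt0.
  exists (Num.truncn e^-1) => n n0n.
  rewrite invf_ple ?posrE// ltW// (lt_le_trans (truncnS_gt _))// ler_nat ltnS.
  exact: n0n.
have ballE v w (e : R) : ball v e%:C%C w = (psd_norm cform (v - w) < e) :> Prop.
  by rewrite -ball_normE/= completion_normE ltcR.
have /choice[u uF] n : exists u, F (ball u (d n)%:C%C).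
  by apply: cF; rewrite ltcR.
have /choice[a ua] n : exists a, psd_norm cform (u n - cincl a) <= d n.
  have [n0 /(_ n0 (leqnn _)) h0] := cincl_cvg (crepP (u n)) (d_gt0 n).
  by exists (crep (u n) n0).
have uu m n : psd_norm cform (u m - u n) <= d m + d n.
  have [v []] := filter_ex (filterI (uF m) (uF n)).
  rewrite !ballE => /ltW mv /ltW nv.
    by rewrite psd_normB in nv; exact: psd_norm_le_trans mv nv.
have ca : psd_cauchy b a.
  move=> e e0; have e4 : 0 < e / 4 by rewrite divr_gt0.
  have [n0 h0] := d_small _ e4; exists n0 => m n /h0 dm /h0 dn.
  have -> : psd_norm b (a m - a n) = psd_norm cform (cincl (a m) - cincl (a n)).
    by rewrite -raddfB psd_norm_cincl.
  have ua' := ua m; rewrite psd_normB in ua'.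
  have le_e : d m + (d m + d n + d n) <= e by clear -dm dn e0; lra.
  exact: le_trans (psd_norm_le_trans ua' (psd_norm_le_trans (uu m n) (ua n))) le_e.
have [G aG] := psd_cauchy_represents ca.
have GP : G \in representable by apply/asboolP; exists a.
apply/cvg_ex; exists (Completion GP); apply/fcvg_ballP => e e0.
have [e' e'0 ->] : exists2 e' : R, 0 < e' & e = e'%:C%C.
  move: e0; rewrite ltcE => /andP[/eqP/= ei er]; exists (complex.Re e) => //.
  by apply/eqP; rewrite eq_complex/= eqxx ei eqxx.
have e4 : 0 < e' / 4 by rewrite divr_gt0.
have [n0 h0] := d_small _ e4.
have [n1 h1] := cincl_cvg (aG : represents b a (Completion GP)) e4.
have [n {h0}h0 {h1}h1] : exists2 n, d n <= e' / 4 &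
    psd_norm cform (Completion GP - cincl (a n)) <= e' / 4.
  by exists (maxn n0 n1); [exact: h0 (leq_maxl _ _)|exact: h1 (leq_maxr _ _)].
apply: filterS (uF n) => v; rewrite !ballE => uv.
have ua' := ua n; rewrite psd_normB in ua'.
have lt_e : e' / 4 + (d n + d n) < e' by clear -h0 e'0; lra.
exact: le_lt_trans (psd_norm_le_trans h1 (psd_norm_le_trans ua' (ltW uv))) lt_e.
Qed.

HB.instance Definition _ := Uniform_isComplete.Build completion completion_complete.

Fact completion_hdot_normE u :
  `|u| ^+ 2 = (psd_dot cform : {dot completion for Num.conj}) u u.
Proof. by rewrite /= psd_dotxx completion_normE -rmorphXn/= sqr_psd_norm. Qed.

HB.instance Definition _ := CompleteNormedModule_isHilbert.Build R completion
  completion_hdot_normE.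

(** Well-definedness of the extended operator: asymptotic sequences have asymptotic images under a
    bounded map. *)
Lemma represents_lip (A : {linear E -> E}) (M : R) a a' F :
  (forall x, psd_norm b (A x) <= M * psd_norm b x) ->
  represents b a F -> represents b a' F ->
  forall G, represents b (A \o a) G -> represents b (A \o a') G.
Proof.
move=> AM ra ra' G [cA AG].
have M0 : 0 < `|M| + 1 by rewrite ltr_pwDr.
have AM' x : psd_norm b (A x) <= (`|M| + 1) * psd_norm b x.
  rewrite (le_trans (AM _))// ler_wpM2r ?psd_norm_ge0//.
  by rewrite (le_trans (ler_norm _))// lerDl.
split=> [e e0|x].
  have [n0 h0] := ra'.1 _ (divr_gt0 e0 M0); exists n0 => m n m0 nn0.
  rewrite /= -raddfB (le_trans (AM' _))// mulrC -ler_pdivlMr//.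
  exact: h0.
rewrite (_ : (fun n => _) = fun n => b (A (a n)) x - b (A (a n - a' n)) x); last first.
  by apply/funext => n; rewrite -psdBl -raddfB opprB addrC subrK.
rewrite -[G x]subr0; apply: cvgB; first exact: AG.
apply/cvgrPdist_le => e e0.
have N0 : 0 < (`|M| + 1) * (psd_norm b x + 1).
  by rewrite mulr_gt0// ltr_pwDr// psd_norm_ge0.
have [n0 h0] := represents_close ra ra' (divr_gt0 e0 N0).
exists n0 => // n /= /h0 hn; rewrite sub0r normrN.
apply: le_trans (psd_CauchySchwarz b _ _) _.
apply: (@le_trans _ _ ((`|M| + 1) * psd_norm b (a n - a' n) * (psd_norm b x + 1))).
  by apply: ler_pM; rewrite ?psd_norm_ge0 ?lerDl.
by rewrite mulrAC mulrC -ler_pdivlMr.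
Qed.

Lemma represents_lip_ex (A : {linear E -> E}) (M : R) a :
  (forall x, psd_norm b (A x) <= M * psd_norm b x) ->
  psd_cauchy b a -> psd_cauchy b (A \o a).
Proof.
move=> AM ca; have M0 : 0 < `|M| + 1 by rewrite ltr_pwDr.
move=> e e0; have [n0 h0] := ca _ (divr_gt0 e0 M0); exists n0 => m n m0 nn0.
rewrite /= -raddfB (le_trans (AM _))//.
apply: (@le_trans _ _ ((`|M| + 1) * psd_norm b (a m - a n))).
  rewrite ler_wpM2r ?psd_norm_ge0//.
  by rewrite (le_trans (ler_norm _))// lerDl.
by rewrite mulrC -ler_pdivlMr//; exact: h0.
Qed.

(** The norm bound is stated for every admissible [M'], so that one extension serves both the l^1
    estimate and the contraction estimate for partial translations. *)
Lemma completion_extend (A : {linear E -> E}) (M : R) : 0 <= M ->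
  (forall x, psd_norm b (A x) <= M * psd_norm b x) ->
  exists L : {linear completion -> completion},
    (forall x, L (cincl x) = cincl (A x)) /\
    (forall M', 0 <= M' -> (forall x, psd_norm b (A x) <= M' * psd_norm b x) ->
       forall u, psd_norm cform (L u) <= M' * psd_norm cform u).
Proof.
move=> M0 AM.
have /choice[f fP] (u : completion) :
    exists v : completion, represents b (A \o crep u) v.
  have [F FP] := psd_cauchy_represents (represents_lip_ex AM (crepP u).1).
  have FP' : F \in representable by apply/asboolP; exists (A \o crep u).
  by exists (Completion FP').
have fE (u : completion) a : represents b a u -> represents b (A \o a) (f u).
  by move=> au; exact: represents_lip AM (crepP u) au _ (fP u).
have runiq a (u v : completion) : represents b a u -> represents b a v -> u = v.
  move=> [_ au] [_ av]; apply: completion_ext => x.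
  exact: cvg_unique (au x) (av x).
have f_lin : linear f.
  move=> c u v; apply: runiq (fP _) _.
  have uv : represents b (fun n => c *: crep u n + crep v n) (c *: u + v) :=
    representsD (representsZ c (crepP u)) (crepP v).
  apply: represents_lip AM uv (crepP _) _ _.
  have -> : A \o (fun n => c *: crep u n + crep v n) =
            fun n => c *: A (crep u n) + A (crep v n).
    by apply/funext => n /=; rewrite linearP.
  exact: representsD (representsZ c (fP u)) (fP v).
pose fL := GRing.isLinear.Build R[i] completion completion *:%R f f_lin.
pose L : {linear completion -> completion} := HB.pack f fL.
exists L; split=> [x|M' M'0 AM' u].
  have hx : represents b _ (cincl x) := represents_cst x.
  apply: runiq (fE _ _ hx) _.
  exact: (represents_cst (A x)).
rewrite /=.
have h := cdot_reP (crepP u) (crepP u).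
have h' : b (A (crep u n)) (A (crep u n)) @[n --> \oo] --> cform (f u) (f u).
  exact: cdot_reP (fP u) (fP u).
have := psd_norm_ge0 cform u; have := psd_norm_ge0 cform (f u).
have := sqr_psd_norm cform u; have := sqr_psd_norm cform (f u).
move: (psd_norm cform u) (psd_norm cform (f u)) => nu nfu nfuE nuE nfu0 nu0.
rewrite -(@ler_pXn2r _ 2)// ?nnegrE ?mulr_ge0// exprMn nfuE nuE.
have h2 : M' ^+ 2 * b (crep u n) (crep u n) @[n --> \oo] --> M' ^+ 2 * cform u u.
  exact: (cvgM (cvg_cst _) h).
rewrite -(cvg_lim _ h')// -(cvg_lim _ h2)//.
apply: ler_lim; do ?by apply/cvg_ex; eexists; eauto.
apply: nearW => n /=; rewrite -!sqr_psd_norm -exprMn.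
by rewrite ler_pXn2r// ?nnegrE ?mulr_ge0 ?psd_norm_ge0.
Qed.

End Completion.

(** These three properties are all that is used of the completion from here on. *)
Lemma hilbert_completion (R : realType) (E : lmodType R[i]) (b : psd_form E) :
  exists (K : hilbertType R) (j : {linear E -> K}),
  [/\ forall x y, complex.Re (hdot (j x) (j y)) = b x y,
    forall v e, 0 < e -> exists x, rnorm (v - j x) <= e &
    forall (A : {linear E -> E}) (M : R), 0 <= M ->
    (forall x, psd_norm b (A x) <= M * psd_norm b x) ->
    exists L : {linear K -> K},
    (forall x, L (j x) = j (A x)) /\
    (forall M', 0 <= M' -> (forall x, psd_norm b (A x) <= M' * psd_norm b x) ->
       forall u, rnorm (L u) <= M' * rnorm u)].
Proof.
exists (completion b), (@cincl R E b : {linear E -> completion b}).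
split=> [x y|v e e0|A M M0 AM].
- exact: cdot_cincl.
- have [n0 /(_ _ (leqnn _)) h0] := cincl_cvg (crepP v) e0.
  by exists (crep v n0).
- exact: (completion_extend M0 AM).
Qed.

Transparent psd_norm cdot_re.

(** * Schoenberg's theorem *)

Lemma cvg_sumr (R : realType) (T : Type) (F : set_system T) (FF : Filter F)
    (J : Type) (r : seq J) (P : pred J) (f : J -> T -> R) (l : J -> R) :
  (forall j, P j -> f j x @[x --> F] --> l j) ->
  \sum_(j <- r | P j) f j x @[x --> F] --> \sum_(j <- r | P j) l j.
Proof.
move=> fl; elim: r => [|j r IH].
  by under eq_fun do rewrite big_nil; rewrite big_nil; exact: cvg_cst.
under eq_fun do rewrite big_cons; rewrite big_cons.
by case: ifP => // Pj; apply: cvgD => //; exact: fl.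
Qed.

Section Kernels.
Variables (R : realType) (I : finType).
Implicit Types (k : I -> I -> R) (c f : I -> R).

Definition psd_kernel k := (forall i j, k i j = k j i) /\
  forall c, 0 <= \sum_i \sum_j c i * c j * k i j.

Lemma psd_kernel_ext k k' : (forall i j, k i j = k' i j) ->
  psd_kernel k -> psd_kernel k'.
Proof. by move=> kk'; rewrite (_ : k = k')//; do 2!apply/funext => ?; rewrite kk'. Qed.

Lemma psd_kernelD k k' : psd_kernel k -> psd_kernel k' ->
  psd_kernel (fun i j => k i j + k' i j).
Proof.
move=> [ks kp] [ks' kp']; split=> [i j|c]; first by rewrite ks ks'.
have := addr_ge0 (kp c) (kp' c); congr (0 <= _); rewrite -big_split/=.
apply: eq_bigr => i _; rewrite -big_split/=.
by apply: eq_bigr => j _; rewrite mulrDr.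
Qed.

Lemma psd_kernelZ (r : R) k : 0 <= r -> psd_kernel k ->
  psd_kernel (fun i j => r * k i j).
Proof.
move=> r0 [ks kp]; split=> [i j|c]; first by rewrite ks.
have := mulr_ge0 r0 (kp c); congr (0 <= _); rewrite mulr_sumr.
apply: eq_bigr => i _; rewrite mulr_sumr.
by apply: eq_bigr => j _; rewrite mulrCA.
Qed.

Lemma psd_kernel_conj f k : psd_kernel k ->
  psd_kernel (fun i j => f i * f j * k i j).
Proof.
move=> [ks kp]; split=> [i j|c]; first by rewrite ks (mulrC (f i)).
have := kp (fun i => c i * f i); congr (0 <= _).
by apply: eq_bigr => i _; apply: eq_bigr => j _; ring.
Qed.

Lemma psd_kernel0 : psd_kernel (fun _ _ => 0).
Proof.
by split=> // c; apply: sumr_ge0 => i _; apply: sumr_ge0 => j _; rewrite mulr0.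
Qed.

Lemma psd_kernel1 : psd_kernel (fun _ _ => 1).
Proof.
split=> // c; have := sqr_ge0 (\sum_i c i); congr (0 <= _).
rewrite expr2 mulr_suml; apply: eq_bigr => i _; rewrite mulr_sumr.
by apply: eq_bigr => j _; rewrite mulr1.
Qed.

Lemma sum_delta_mul p f : \sum_i (i == p)%:R * f i = f p.
Proof.
rewrite (bigD1 p)//= eqxx mul1r big1 ?addr0// => i /negPf ->.
by rewrite mul0r.
Qed.

(** Expansion of the quadratic form along the point mass at p. It serves for the diagonal lemmas,
    for the elimination step of the Schur product, and for the displacement of the almost invariant
    vectors. *)
Lemma kernel_shift k c p (s : R) : (forall i j, k i j = k j i) ->
  \sum_i \sum_j (c i + s * (i == p)%:R) * (c j + s * (j == p)%:R) * k i j =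
  \sum_i \sum_j c i * c j * k i j + s * (\sum_j c j * k p j) *+ 2 + s ^+ 2 * k p p.
Proof.
move=> ks.
have -> : \sum_i \sum_j (c i + s * (i == p)%:R) * (c j + s * (j == p)%:R) * k i j =
  \sum_i ((\sum_j c i * c j * k i j + s * (c i * k i p)) +
    (i == p)%:R * (s * (\sum_j c j * k i j) + s ^+ 2 * k i p)).
  apply: eq_bigr => i _.
  rewrite -(sum_delta_mul p (fun j => c i * k i j)).
  rewrite -(sum_delta_mul p (fun j => k i j)).
  rewrite !mulr_sumr -!big_split/= mulr_sumr -big_split/=.
  by apply: eq_bigr => j _; ring.
rewrite big_split/= sum_delta_mul big_split/= -mulr_sumr.
under [in X in _ + s * X + _]eq_bigr do rewrite ks.
by ring.
Qed.

Lemma psd_kernel_diag_ge0 k i : psd_kernel k -> 0 <= k i i.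
Proof.
move=> [ks /(_ (fun j => 0 + 1 * (j == i)%:R))]; rewrite kernel_shift//.
rewrite !big1 ?(add0r, mulr0, mul0rn, expr1n, mul1r)// => j _;
  rewrite ?big1// => *; by rewrite !mul0r.
Qed.

(** If [k i i = 0], the form at the point mass at j plus s times that at i is affine in s with slope
    [2 * k i j]; the s below would give it the value -1. *)
Lemma psd_kernel_diag0 k i j : psd_kernel k -> k i i = 0 -> k i j = 0.
Proof.
move=> [ks kp] ki; apply/eqP/negPn/negP => kij.
pose s := - (k j j + 1) / (2 * k i j).
have := kp (fun l => (l == j)%:R + s * (l == i)%:R).
rewrite kernel_shift// ki mulr0 addr0.
under eq_bigr do under eq_bigr do rewrite -mulrA.
under eq_bigr do rewrite -mulr_sumr sum_delta_mul.
rewrite !sum_delta_mul.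
have -> : s * k i j *+ 2 = - (k j j + 1) by rewrite /s; field.
lra.
Qed.

(* Schur product by Cholesky elimination: subtracting from [k] the rank one
   kernel through a point [p] with [k p p != 0] kills the diagonal at [p]. *)
Lemma psd_kernelM k k' : psd_kernel k -> psd_kernel k' ->
  psd_kernel (fun i j => k i j * k' i j).
Proof.
move=> kP k'P.
have [m] := ubnP #|[pred i | k i i != 0]|.
elim: m k kP => // m IH k kP km; have [ks kp] := kP.
have [[p kpp]|k0] := pselect (exists p, k p p != 0); last first.
  apply: psd_kernel_ext psd_kernel0 => i j.
  rewrite (@psd_kernel_diag0 k i j) ?mul0r//.
  by apply/eqP/negPn/negP => ki; apply: k0; exists i.
have kpp0 : 0 < k p p by rewrite lt_def kpp psd_kernel_diag_ge0.
pose k1 i j := k i j - (k p p)^-1 * (k p i * k p j).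
have k1P : psd_kernel k1.
  split=> [i j|c]; first by rewrite /k1 ks (mulrC (k p i)).
  (* This shift minimises the form along the point mass at p; the minimum is the form of [k1], the
     Schur complement. *)
  have := kp (fun l => c l + - ((\sum_j c j * k p j) / k p p) * (l == p)%:R).
  rewrite kernel_shift//; congr (0 <= _).
  have -> : \sum_i \sum_j c i * c j * k1 i j =
      \sum_i \sum_j c i * c j * k i j -
      (k p p)^-1 * ((\sum_j c j * k p j) * (\sum_j c j * k p j)).
    rewrite mulr_suml mulr_sumr -sumrB; apply: eq_bigr => i _.
    rewrite !mulr_sumr -sumrB; apply: eq_bigr => j _; rewrite /k1; ring.
  by field.
have /IH k1k' := k1P.
apply: (@psd_kernel_ext (fun i j => k1 i j * k' i j +
    (k p p)^-1 * (k p i * k p j * k' i j))).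
  by move=> i j; rewrite /k1; ring.
apply: psd_kernelD; last first.
  by apply: psd_kernelZ; [rewrite invr_ge0 ltW|exact: psd_kernel_conj].
(* The number of nonzero diagonal entries drops: p is lost, and a zero entry stays zero because the
   whole row through it vanishes. *)
apply: k1k'; apply: leq_trans _ (km : (_ <= m)%N); apply/proper_card/properP; split.
  apply/fintype.subsetP => i; rewrite !inE; apply: contra_neq => ki.
  by rewrite /k1 ki sub0r ks (@psd_kernel_diag0 k i p) ?mul0r ?mulr0 ?oppr0.
exists p; rewrite !inE//= negbK /k1 mulKf// subrr//.
Qed.

Lemma psd_kernelX k n : psd_kernel k -> psd_kernel (fun i j => k i j ^+ n).
Proof.
move=> kP; elim: n => [|n IH]; first exact: psd_kernel_ext psd_kernel1.
by apply: psd_kernel_ext (psd_kernelM kP IH) => i j; rewrite exprS.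
Qed.

Lemma psd_kernel_sum n (k : nat -> I -> I -> R) : (forall m, psd_kernel (k m)) ->
  psd_kernel (fun i j => \sum_(0 <= m < n) k m i j).
Proof.
move=> kP; elim: n => [|n IH].
  by apply: psd_kernel_ext psd_kernel0 => i j; rewrite big_geq.
apply: psd_kernel_ext (psd_kernelD IH (kP n)) => i j.
by rewrite big_nat_recr.
Qed.

Lemma psd_kernel_cvg (k : nat -> I -> I -> R) (l : I -> I -> R) :
  (forall m, psd_kernel (k m)) ->
  (forall i j, k m i j @[m --> \oo] --> l i j) -> psd_kernel l.
Proof.
move=> kP kl; split=> [i j|c].
  apply: cvg_unique (kl i j) _ => //=.
  by under eq_fun do rewrite (kP _).1; exact: kl.
have h : \sum_i \sum_j c i * c j * k m i j @[m --> \oo] -->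
    \sum_i \sum_j c i * c j * l i j.
  apply: cvg_sumr => i _; apply: cvg_sumr => j _.
  exact: (cvgM (cvg_cst _) (kl i j)).
rewrite -(cvg_lim _ h)//; apply: limr_ge; first by apply/cvg_ex; eexists; exact: h.
by apply: nearW => m; exact: (kP m).2.
Qed.

(** The exponential series has nonnegative coefficients, and semidefinite kernels are closed under
    Schur powers, sums and pointwise limits. *)
Lemma psd_kernel_exp k : psd_kernel k -> psd_kernel (fun i j => expR (k i j)).
Proof.
move=> kP; apply: (@psd_kernel_cvg (fun n i j => series (exp_coeff (k i j)) n)).
  move=> n; apply: (@psd_kernel_sum n (fun m i j => exp_coeff (k i j) m)) => m.
  apply: (@psd_kernel_ext (fun i j => m`!%:R^-1 * k i j ^+ m)).
    by move=> i j; rewrite /exp_coeff /= mulrC.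
  by apply: psd_kernelZ; [rewrite invr_ge0|exact: psd_kernelX].
by move=> i j; exact: is_cvg_series_exp_coeff.
Qed.

Lemma psd_suml (E : lmodType R[i]) (b : psd_form E) (u : I -> E) y :
  b (\sum_i u i) y = \sum_i b (u i) y.
Proof.
apply: (big_morph (b^~ y)) => [x x'|]; first exact: psdDl.
exact: psd0l.
Qed.

Lemma psd_kernel_gram (E : lmodType R[i]) (b : psd_form E) (u : I -> E) :
  psd_kernel (fun i j => b (u i) (u j)).
Proof.
split=> [i j|c]; first exact: psdC.
have := psd_ge0 b (\sum_i (c i)%:C%C *: u i); congr (0 <= _).
rewrite psd_suml; apply: eq_bigr => i _; rewrite psdC psd_suml.
by apply: eq_bigr => j _; rewrite psdZr psdZrr psdC; ring.
Qed.

(** Expanding the square, exp(-t |u_i - u_j|^2) = f_i f_j exp(2t <u_i, u_j>) with f_i = exp(-t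
    |u_i|^2): a rescaling of the exponential of a Gram kernel. *)
Lemma psd_kernel_gauss (E : lmodType R[i]) (b : psd_form E) (u : I -> E) (t : R) :
  0 <= t -> psd_kernel (fun i j => expR (- (t * b (u i - u j) (u i - u j)))).
Proof.
move=> t0; pose f i := expR (- (t * b (u i) (u i))).
apply: (@psd_kernel_ext (fun i j => f i * f j * expR (2 * t * b (u i) (u j)))).
  move=> i j; rewrite /f -!expRD; congr expR.
  by rewrite psdBl !psdBr (psdC b (u j) (u i)); ring.
apply: psd_kernel_conj; apply: psd_kernel_exp; apply: psd_kernelZ.
  by rewrite mulr_ge0.
exact: psd_kernel_gram.
Qed.

End Kernels.

(** * The uniform Roe algebra of the disjoint union *)

Section WordLength.
Variables (R : realType) (gT : finGroupType) (S : {set gT}).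
Hypotheses (Sgen : <<S>>%g = [set: gT]%SET) (Ssym : (S^-1)%g = S).
Implicit Types g h : gT.
Local Notation wl := (word_length R S).

Lemma word_ex g : exists k, g \in (S ^+ k)%g.
Proof.
have /gen_prodgP[k [c cS ->]] : g \in <<S>>%g by rewrite Sgen inE.
exists k; elim: k c cS => [c _|k IH c cS]; first by rewrite big_ord0 expg0 inE.
by rewrite big_ord_recr/= expgSr mem_mulg// IH.
Qed.

Definition word_len g : nat := ex_minn (word_ex g).

Lemma word_len_mem g : g \in (S ^+ word_len g)%g.
Proof. by rewrite /word_len; case: ex_minnP. Qed.

Lemma word_len_le g k : g \in (S ^+ k)%g -> (word_len g <= k)%N.
Proof. by rewrite /word_len; case: ex_minnP => m _ h /h. Qed.

Lemma word_lengthE g : wl g = (word_len g)%:R.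
Proof.
apply/le_anti/andP; split.
  apply: ge_inf; last by exists (word_len g); rewrite ?word_len_mem.
  by exists 0 => _ [k _ ->].
apply: lb_le_inf; first by exists (word_len g)%:R, (word_len g); rewrite ?word_len_mem.
by move=> _ [k /word_len_le kg ->]; rewrite ler_nat.
Qed.

Lemma word_len1 : word_len 1 = 0%N.
Proof. by apply/eqP; rewrite -leqn0 word_len_le// expg0 inE. Qed.

Lemma word_lenM g h : (word_len (g * h) <= word_len g + word_len h)%N.
Proof. by apply: word_len_le; rewrite expgD mem_mulg ?word_len_mem. Qed.

Lemma word_lenV g : word_len g^-1 = word_len g.
Proof.
suff H h : (word_len h^-1 <= word_len h)%N.
  by apply/eqP; rewrite eqn_leq H/= -{1}[g]invgK H.
apply: word_len_le; have : h^-1%g \in ((S ^+ word_len h)^-1)%g.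
  by rewrite memV_invg word_len_mem.
suff -> : ((S ^+ word_len h)^-1 = S ^+ word_len h)%g by [].
elim: (word_len h) => [|k IH]; first by rewrite expg0 invg1.
by rewrite expgS invMg IH Ssym -expgSr expgS.
Qed.

Lemma word_len_gen g : g \in S -> (word_len g <= 1)%N.
Proof. by move=> gS; apply: word_len_le; rewrite expg1. Qed.

(** A shortest word for g is cut after m letters. This turns long elements into elements of
    controlled length. *)
Lemma word_len_split g m : (m <= word_len g)%N ->
  exists h, (word_len h <= m)%N /\ (word_len (h^-1 * g) <= word_len g - m)%N.
Proof.
move=> mg; have := word_len_mem g; rewrite -{1}(subnKC mg) expgD.
move=> /mulsgP[h h' hm h'm gE]; exists h; split; first exact: word_len_le.
by rewrite {1}gE mulKg word_len_le.
Qed.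

Lemma card_word_ball m :
  (#|[set g | (word_len g <= m)%N]%SET| <= \sum_(i < m.+1) #|S| ^ i)%N.
Proof.
have card_exp i : (#|(S ^+ i)%g| <= #|S| ^ i)%N.
  elim: i => [|i IH]; first by rewrite expg0 cards1 expn0.
  rewrite expgS expnS; apply: leq_trans (leq_mul (leqnn _) IH).
  rewrite -cardsX.
  have -> : (S * S ^+ i)%g = ((fun x : gT * gT => x.1 * x.2) @: finset.setX S (S ^+ i))%g.
    apply/setP => g; apply/mulsgP/imsetP => [[x y xS yS ->]|[[x y]]].
      by exists (x, y) => //; rewrite inE xS.
    by rewrite inE/= => /andP[xS yS] ->; exists x y.
  exact: leq_imset_card.
elim: m => [|m IH].
  rewrite big_ord1 expn0 -(cards1 (1%g : gT)) subset_leq_card//.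
  apply/fintype.subsetP => g; rewrite !inE leqn0 => /eqP g0.
  by have := word_len_mem g; rewrite g0 expg0 inE.
rewrite big_ord_recr/=; apply: leq_trans (leq_add IH (card_exp _)).
apply: leq_trans (leq_card_setU _ _); apply/subset_leq_card/fintype.subsetP => g.
rewrite !inE leq_eqVlt => /orP[/eqP <-|]; first by rewrite word_len_mem orbT.
by rewrite ltnS => ->.
Qed.

End WordLength.

Section ComplexModulus.
Variable R : realType.
Implicit Types c : R[i].

Definition cmod c : R := rnorm (c : R[i]^o).

Lemma cmodM c c' : cmod (c * c') = cmod c * cmod c'.
Proof. exact: Normc.normcM. Qed.

Lemma cmodD c c' : cmod (c + c') <= cmod c + cmod c'.
Proof. exact: le_normcD. Qed.

Lemma cmod0 : cmod 0 = 0. Proof. exact: Normc.normc0. Qed.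

Lemma cmod1 : cmod 1 = 1. Proof. exact: Normc.normc1. Qed.

Lemma cmod_ge0 c : 0 <= cmod c.
Proof. by case: c => x y; exact: sqrtr_ge0. Qed.

Lemma sqr_cmod c : cmod c ^+ 2 = complex.Re c ^+ 2 + complex.Im c ^+ 2.
Proof. by case: c => x y; rewrite sqr_sqrtr// addr_ge0// sqr_ge0. Qed.

Lemma cmod_sum (J : Type) (r : seq J) (P : pred J) (f : J -> R[i]) :
  cmod (\sum_(j <- r | P j) f j) <= \sum_(j <- r | P j) cmod (f j).
Proof.
elim/big_ind2 : _ => [|x x' y y' xx' yy'|//]; first by rewrite cmod0.
exact: le_trans (cmodD _ _) (lerD xx' yy').
Qed.

End ComplexModulus.

(** * Matrices of bounded propagation on the disjoint union *)

Section Matrices.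
Variables (R : realType) (G : nat -> finGroupType) (S : forall n, {set G n}).
Hypotheses (Sgen : forall n, <<S n>>%g = [set: G n]%SET)
           (Sfin : exists k, forall n, (#|S n| <= k)%N).
Local Notation X := {n : nat & G n}.
Local Notation C := R[i].
Local Notation matX := (X -> X -> C).
Local Notation d := (union_dist R S).
Local Notation wl := (word_len (@Sgen _)).
Local Notation tg := (Tagged G).
Implicit Types T V : matX.

Lemma union_dist_Tagged n (g h : G n) :
  d (tg g) (tg h) = ((wl (g^-1 * h)%g)%:R)%:E.
Proof. by rewrite /union_dist/= eqxx tagged_asE /word_dist word_lengthE. Qed.

Lemma union_dist_tag x y (r : R) : (d x y <= r%:E)%E -> tag x = tag y.
Proof. by rewrite /union_dist; case: eqP => // _; rewrite leye_eq. Qed.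

Lemma eq_block (T T' : matX) :
  (forall x y, tag x <> tag y -> T x y = 0) ->
  (forall x y, tag x <> tag y -> T' x y = 0) ->
  (forall n (g h : G n), T (tg g) (tg h) = T' (tg g) (tg h)) -> T = T'.
Proof.
move=> T0 T'0 TT'; apply/funext => -[n g]; apply/funext => -[m h].
have [nm|nm] := eqVneq n m; first by subst m; exact: TT'.
by rewrite T0 ?T'0//=; exact/eqP.
Qed.

(** Working form of membership: as distinct pieces are infinitely far apart, an entourage is block
    diagonal with one propagation bound for all blocks, and this bound may be taken in the natural
    numbers. *)
Lemma CuP T : Cu d T <-> exists (M : R) (m : nat),
  [/\ 0 <= M, forall x y, cmod (T x y) <= M,
      forall x y, tag x <> tag y -> T x y = 0 &
      forall n (g h : G n), T (tg g) (tg h) != 0 -> (wl (g^-1 * h)%g <= m)%N].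
Proof.
split=> [[[M TM] [r Tr]]|[M [m [M0 TM T0 Tm]]]].
  exists `|M|, (Num.truncn r); split=> // [x y|x y xy|n g h gh].
  - exact: le_trans (TM x y) (ler_norm _).
  - apply/eqP/negPn/negP => Txy; apply: xy.
    exact: (union_dist_tag (Tr (x, y) Txy)).
  - have /= := Tr (tg g, tg h) gh.
    rewrite union_dist_Tagged lee_fin => ghr.
    rewrite truncn_ge_nat//; exact: le_trans ghr.
split; first by exists M.
exists m%:R => -[[n g] [n' h]] /= gh.
have [nn'|nn'] := eqVneq n n'; last first.
  by move: gh; rewrite /msupp/= T0 ?eqxx//=; exact/eqP.
by subst n'; rewrite union_dist_Tagged lee_fin ler_nat Tm.
Qed.

Lemma Cu_off T x y : Cu d T -> tag x <> tag y -> T x y = 0.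
Proof. by move=> /CuP[M [m [_ _ + _]]]; exact. Qed.

(** The first factor is block diagonal, so the sum over X lives on the finite piece of g. *)
Lemma mmulE T T' n (g : G n) y : Cu d T ->
  mmul T T' (tg g) y = \sum_(h : G n) T (tg g) (tg h) * T' (tg h) y.
Proof.
move=> CT; rewrite /mmul.
have tg_inj : injective (@Tagged nat n G).
  by move=> h h' /eqP; rewrite -tag_eqE /tag_eq/= eqxx tagged_asE/= => /eqP.
rewrite -(@fsbig_widen _ _ _ _ (range (@Tagged nat n G)))//; last first.
  move=> -[m h] [_ /= xn]; have [nm|nm] := eqVneq n m.
    by subst m; case: xn; exists h.
  by rewrite (Cu_off CT) ?mul0r//=; exact/eqP.
rewrite (reindex_fsbig (@Tagged nat n G) [set: G n]); last first.
  split; [by move=> h _; exists h|by move=> h h' _ _ /tg_inj|].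
  by move=> _ [h _ <-]; exists h.
rewrite fsbig_finite//=.
apply: perm_big; apply: uniq_perm; rewrite ?finmap.fset_uniq ?index_enum_uniq//.
by move=> h; rewrite mem_index_enum in_fset_set; [exact: mem_set|exact: finite_finset].
Qed.

(** Bounded geometry: with k bounding every [#|S n|], a ball of radius m has at most sum_(i <= m)
    k^i points in every piece. *)
Lemma Cu_row T : Cu d T -> exists2 A : R, 0 <= A &
  forall n (g : G n), \sum_(h : G n) cmod (T (tg g) (tg h)) <= A.
Proof.
move=> /CuP[M [m [M0 TM _ Tm]]]; have [k Sk] := Sfin.
exists ((\sum_(i < m.+1) k ^ i)%N%:R * M) => [|n g]; first by rewrite mulr_ge0.
rewrite (bigID (fun h => (wl (g^-1 * h)%g <= m)%N))/= [X in _ + X]big1 ?addr0; last first.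
  move=> h gh; have [->|/Tm] := eqVneq (T (tg g) (tg h)) 0; first exact: cmod0.
  by rewrite (negPf gh).
apply: le_trans (ler_sum _ (fun h _ => TM _ _)) _.
rewrite sumr_const -[leLHS]mulr_natl ler_wpM2r// ler_nat.
apply: (@leq_trans #|[set h | (wl h <= m)%N]%SET|).
  rewrite -(card_imset _ (mulgI g^-1%g)); apply/subset_leq_card/fintype.subsetP.
  by move=> _ /imsetP[h hm ->]; rewrite inE.
apply: leq_trans (card_word_ball _ _) _.
apply: leq_sum => i _; elim: (nat_of_ord i) => // j IH.
by rewrite !expnS leq_mul.
Qed.

Lemma CuD T T' : Cu d T -> Cu d T' -> Cu d (madd T T').
Proof.
move=> /CuP[M [m [M0 TM T0 Tm]]] /CuP[M' [m' [M'0 TM' T0' Tm']]]; apply/CuP.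
exists (M + M'), (maxn m m'); split=> [|x y|x y xy|n g h].
- exact: addr_ge0.
- exact: le_trans (cmodD _ _) (lerD (TM _ _) (TM' _ _)).
- by rewrite /madd T0 ?T0' ?addr0.
- rewrite /madd leq_max.
  have [->|/Tm ->//] := eqVneq (T (tg g) (tg h)) 0.
  by rewrite add0r => /Tm' ->; rewrite orbT.
Qed.

Lemma CuZ (c : C) T : Cu d T -> Cu d (Defs.mscale c T).
Proof.
move=> /CuP[M [m [M0 TM T0 Tm]]]; apply/CuP.
exists (cmod c * M), m; split=> [|x y|x y xy|n g h].
- by rewrite mulr_ge0// cmod_ge0.
- by rewrite cmodM ler_wpM2l// cmod_ge0.
- by rewrite /Defs.mscale T0 ?mulr0.
- by rewrite /Defs.mscale mulf_eq0 negb_or => /andP[_ /Tm].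
Qed.

Lemma CuM T T' : Cu d T -> Cu d T' -> Cu d (mmul T T').
Proof.
move=> CT CT'; have [A A0 TA] := Cu_row CT.
have /CuP[M [m [M0 TM T0 Tm]]] := CT.
have /CuP[M' [m' [M'0 TM' T0' Tm']]] := CT'; apply/CuP.
exists (A * M'), (m + m')%N; split=> [|[n g] y|[n g] [n' h] /= nn'|n g h].
- exact: mulr_ge0.
- rewrite mmulE// (le_trans (cmod_sum _ _ _))//.
  apply: (@le_trans _ _ (\sum_h cmod (T (tg g) (tg h)) * M')).
    by apply: ler_sum => h _; rewrite cmodM ler_wpM2l ?cmod_ge0.
  by rewrite -mulr_suml ler_wpM2r.
- by rewrite mmulE// big1// => l _; rewrite (Cu_off CT')//= mulr0.
- rewrite mmulE//; apply: contraNT; rewrite -ltnNge => gh.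
  rewrite big1// => l _; have [->|/Tm gl] := eqVneq (T (tg g) (tg l)) 0.
    by rewrite mul0r.
  have [->|/Tm' lh] := eqVneq (T' (tg l) (tg h)) 0; first by rewrite mulr0.
  move: gh; rewrite ltnNge => /negP[].
  have -> : (g^-1 * h = (g^-1 * l) * (l^-1 * h))%g by rewrite mulgA mulgK.
  exact: leq_trans (word_lenM _ _ _) (leq_add gl lh).
Qed.

Lemma Cu_diag (f : X -> C) : ell_infty f -> Cu d (mdiag f).
Proof.
move=> [M fM]; apply/CuP; exists `|M|, 0%N; split=> // [x y|x y xy|n g h].
- rewrite /mdiag; case: eqP => _; last by rewrite cmod0.
  exact: le_trans (fM x) (ler_norm _).
- by rewrite /mdiag; case: eqP => // xy'; case: xy; rewrite xy'.
- rewrite /mdiag; case: (tg g =P tg h) => [/eqP|_]; last by rewrite eqxx.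
  rewrite -tag_eqE /tag_eq/= eqxx tagged_asE/= => /eqP <- _.
  by rewrite mulVg word_len1.
Qed.

Lemma ell_infty1 : ell_infty (fun _ : X => 1 : C).
Proof. by exists 1 => x; rewrite -[leLHS]/(cmod 1) cmod1. Qed.

Lemma Cu1 : Cu d (@mone R _ : matX).
Proof. exact/Cu_diag/ell_infty1. Qed.

Lemma mmulDl T T' V : Cu d T -> Cu d T' -> Cu d V ->
  mmul (madd T T') V = madd (mmul T V) (mmul T' V).
Proof.
move=> CT CT' CV; apply: eq_block => [x y xy|x y xy|n g h].
- by apply: Cu_off xy; apply: CuM => //; exact: CuD.
- by apply: Cu_off xy; apply: CuD; exact: CuM.
- rewrite /madd !mmulE//; last exact: CuD.
  by rewrite -big_split/=; apply: eq_bigr => l _; rewrite mulrDl.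
Qed.

Lemma mmulDr T V V' : Cu d T ->
  mmul T (fun x y => V x y + V' x y) = fun x y => mmul T V x y + mmul T V' x y.
Proof.
move=> CT; apply/funext => -[n g]; apply/funext => y; rewrite !mmulE//.
by rewrite -big_split/=; apply: eq_bigr => l _; rewrite mulrDr.
Qed.

Lemma mmulZr T V c : Cu d T ->
  mmul T (fun x y => c * V x y) = fun x y => c * mmul T V x y.
Proof.
move=> CT; apply/funext => -[n g]; apply/funext => y; rewrite !mmulE//.
by rewrite mulr_sumr; apply: eq_bigr => l _; rewrite mulrCA.
Qed.

Lemma mmul0r T : Cu d T -> mmul T (fun _ _ => 0) = fun _ _ => 0.
Proof.
move=> CT; apply/funext => -[n g]; apply/funext => y; rewrite !mmulE//.
by rewrite big1// => l _; rewrite mulr0.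
Qed.

Lemma mmulZl T V c : Cu d T ->
  mmul (Defs.mscale c T) V = Defs.mscale c (mmul T V).
Proof.
move=> CT; apply/funext => -[n g]; apply/funext => y.
rewrite /Defs.mscale mmulE; last exact: CuZ.
by rewrite mmulE// mulr_sumr; apply: eq_bigr => l _; rewrite mulrA.
Qed.

Lemma mmulA T T' V : Cu d T -> Cu d T' ->
  mmul (mmul T T') V = mmul T (mmul T' V).
Proof.
move=> CT CT'; apply/funext => -[n g]; apply/funext => y.
rewrite !mmulE//; last exact: CuM.
under eq_bigr do rewrite mmulE// mulr_suml.
rewrite exchange_big/=; apply: eq_bigr => l _.
by rewrite mmulE// mulr_sumr; apply: eq_bigr => l' _; rewrite mulrA.
Qed.

Lemma mmul_diag (f : X -> C) V : ell_infty f ->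
  mmul (mdiag f) V = fun x y => f x * V x y.
Proof.
move=> fb; apply/funext => -[n g]; apply/funext => y.
rewrite mmulE; last exact: Cu_diag.
rewrite (bigD1 g)//= big1 ?addr0 => [|l lg]; first by rewrite /mdiag eqxx.
rewrite /mdiag ifF ?mul0r//; apply/negP => /eqP/eqP.
by rewrite -tag_eqE /tag_eq/= eqxx tagged_asE/= eq_sym (negPf lg).
Qed.

Lemma mmul1l V : mmul (@mone R _ : matX) V = V.
Proof.
rewrite mmul_diag; last exact: ell_infty1.
by do 2!apply/funext => ?; rewrite mul1r.
Qed.

End Matrices.

(** * Right translations and the decomposition of matrices *)

Section PartialTranslations.
Variables (R : realType) (G : nat -> finGroupType) (S : forall n, {set G n}).
Hypotheses (Sgen : forall n, <<S n>>%g = [set: G n]%SET)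
           (Sfin : exists k, forall n, (#|S n| <= k)%N).
Local Notation X := {n : nat & G n}.
Local Notation C := R[i].
Local Notation matX := (X -> X -> C).
Local Notation d := (union_dist R S).
Local Notation wl := (word_len (@Sgen _)).
Local Notation tg := (Tagged G).
Implicit Types (T V : matX) (D : pred nat) (w : forall n, G n).

Lemma le_sup_norm (f : X -> C) x : ell_infty f -> cmod (f x) <= sup_norm f.
Proof.
move=> [M fM]; apply: sup_upper_bound; last by exists x.
split; first by exists (cmod (f x)), x.
by exists M => _ [y _ <-]; exact: fM.
Qed.

Lemma sup_norm_ge0 (f : X -> C) : ell_infty f -> 0 <= sup_norm f.
Proof. by move=> /(le_sup_norm (tg (1%g : G 0%N))); exact/le_trans/cmod_ge0. Qed.

Lemma Tagged_eqE n (g h : G n) : (tg g == tg h) = (g == h).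
Proof. by rewrite -tag_eqE /tag_eq/= eqxx tagged_asE. Qed.

(** The metric is left invariant, so right multiplication by [w n] moves each point by exactly the
    length of [w n]. [D] selects the pieces on which the translation is defined. *)
Definition right_translation (D : pred nat) (w : forall n, G n) : matX :=
  fun x y => (D (tag x) && (y == tg (tagged x * w (tag x))%g))%:R.

Lemma right_translation_Tagged D w n (g h : G n) :
  right_translation D w (tg g) (tg h) = (D n && (h == g * w n)%g)%:R.
Proof. by rewrite /right_translation/= Tagged_eqE. Qed.

Lemma right_translationP D w m : (forall n, D n -> (wl (w n) <= m)%N) ->
  partial_translation d (right_translation D w).
Proof.
move=> wm; split.
- apply/(CuP Sgen); exists 1, m; split=> // [x y|x y xy|n g h].
  + by rewrite /right_translation; case: (_ && _); rewrite ?cmod1 ?cmod0.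
  + rewrite /right_translation; case: eqP => [yE|]; last by rewrite andbF.
    by case: xy; rewrite yE.
  + rewrite right_translation_Tagged; case: (D n) (wm n) => //= [/(_ isT)|_].
      by case: (h =P _) => [->|]; rewrite ?eqxx ?mulKg.
    by rewrite eqxx.
- by move=> x y; rewrite /right_translation; case: (_ && _); [right|left].
- move=> x y y'; rewrite /right_translation.
  case: (D _) => /=; last by rewrite eqxx.
  case: (y =P _) => [->|_]; last by rewrite eqxx.
  by case: (y' =P _) => [->|_]; rewrite ?eqxx.
- move=> x x' y; rewrite /right_translation.
  case: (D (tag x)) => /=; last by rewrite eqxx.
  case: (y =P _) => [->|_]; last by rewrite eqxx.
  case: (D (tag x')) => /=; last by rewrite eqxx.
  move=> _; rewrite pnatr_eq0 eqb0 negbK.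
  case: x x' => [n g] [n' g'] /=; have [nn'|nn'] := eqVneq n n'.
    by subst n'; rewrite Tagged_eqE => /eqP/mulIg ->.
  by rewrite -tag_eqE /tag_eq/= (negPf nn').
Qed.

Lemma chi_setT : chi R [set: X] = (@mone R _ : matX).
Proof.
rewrite /chi; congr mdiag; apply/funext => x; by rewrite asboolT.
Qed.

Lemma right_translation_range w :
  mrange (right_translation xpredT w) = [set: X].
Proof.
apply/seteqP; split=> // -[n g] _; exists (tg (g * w n)%g).
by rewrite right_translation_Tagged eqxx.
Qed.

(* Without it [l1_norm T] could be the junk infimum 0 of the empty set, and no
   nonzero operator would satisfy the norm bound. *)
Lemma Cu_decomposition T : Cu d T ->
  exists N (f : 'I_N -> X -> C) (V : 'I_N -> matX),
    [/\ forall i, ell_infty (f i), forall i, partial_translation d (V i) &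
        forall x y, T x y = \sum_(i < N) f i x * V i x y].
Proof.
move=> CT; have /(CuP Sgen)[M [m [M0 TM T0 Tm]]] := CT; have [k Sk] := Sfin.
(* The ball of radius m about the unit is enumerated in each group, and the j-th partial translation
   multiplies by its j-th element. *)
pose e n := enum [set h : G n | (wl h <= m)%N]%SET.
have e_size n : (size (e n) <= \sum_(i < m.+1) k ^ i)%N.
  rewrite -cardE; apply: leq_trans (card_word_ball _ _) _.
  apply: leq_sum => i _; elim: (nat_of_ord i) => // j IH.
  by rewrite !expnS leq_mul.
pose w (j : nat) n := nth 1%g (e n) j.
(* Pieces whose ball has at most j elements are left out; there [nth] returns its default 1, and the
   diagonal would be counted again. *)
pose D (j : nat) n := (j < size (e n))%N.
exists (\sum_(i < m.+1) k ^ i)%N.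
exists (fun j x => T x (tg (tagged x * w j (tag x))%g)).
exists (fun j => right_translation (D j) (w j)); split=> [j|j|x y].
- by exists M => x; exact: TM.
- apply: (@right_translationP _ _ m) => n jn.
  by have := mem_nth 1%g jn; rewrite mem_enum inE.
- case: x y => [n g] [n' h]; have [nn'|nn'] := eqVneq n n'; last first.
    rewrite T0; last exact/eqP.
    rewrite big1// => j _.
    rewrite /right_translation -tag_eqE /tag_eq/= eq_sym (negPf nn').
    by rewrite andbF mulr0.
  subst n'.
  under eq_bigr do rewrite right_translation_Tagged.
  have [ghm|ghm] := leqP (wl (g^-1 * h)%g) m; last first.
    rewrite big1 => [|j _].
      by apply/eqP; apply: contraTT ghm => /Tm; rewrite -leqNgt.
    case: eqP => [hE|]; last by rewrite andbF mulr0.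
    rewrite andbT; case: (boolP (D j n)) => [jn|]; last by rewrite mulr0.
    have := mem_nth 1%g jn; rewrite mem_enum inE.
    by rewrite -(mulKg g (nth _ _ _)) -/(w j n) -hE leqNgt ghm.
  have ghe : (g^-1 * h)%g \in e n by rewrite mem_enum inE.
  pose j0 := index (g^-1 * h)%g (e n).
  have j0n : D j0 n by rewrite /D index_mem.
  have j0N : (j0 < \sum_(i < m.+1) k ^ i)%N by apply: leq_trans (e_size n).
  have wj0 : (g * w j0 n = h)%g by rewrite /w nth_index// mulKVg.
  rewrite (bigD1 (Ordinal j0N))//= j0n wj0 eqxx mulr1 big1 ?addr0// => j jj0.
  case: eqP => [hE|]; last by rewrite andbF mulr0.
  rewrite andbT; case: (boolP (D j n)) => [jn|]; last by rewrite mulr0.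
  case/eqP: jj0; apply/val_inj => /=; rewrite /j0 hE mulKg.
  by rewrite index_uniq// enum_uniq.
Qed.

End PartialTranslations.

(** * The representation *)

Section HilbertForm.
Variables (R : realType) (K : hilbertType R).
Implicit Types u v w : K.

Definition hilbert_form_fun u v : R := complex.Re (hdot u v).

Fact hilbert_formC u v : hilbert_form_fun u v = hilbert_form_fun v u.
Proof.
rewrite /hilbert_form_fun hermC expr0 mul1r.
have Re_conj (c : R[i]) : complex.Re (Num.conj c) = complex.Re c by case: c.
exact: Re_conj.
Qed.

Fact hilbert_formDl u u' v :
  hilbert_form_fun (u + u') v = hilbert_form_fun u v + hilbert_form_fun u' v.
Proof.
rewrite /hilbert_form_fun linearDl.
have ReD (c c' : R[i]) : complex.Re (c + c') = complex.Re c + complex.Re c'.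
  by case: c c' => ? ? [].
exact: ReD.
Qed.

Fact hilbert_formZr (r : R) u v :
  hilbert_form_fun (r%:C%C *: u) v = r * hilbert_form_fun u v.
Proof.
rewrite /hilbert_form_fun linearZl_LR.
have ReM (c : R[i]) : complex.Re (r%:C%C * c) = r * complex.Re c.
  by case: c => ? ? /=; ring.
exact: ReM.
Qed.

Fact hilbert_formZ c u v :
  hilbert_form_fun (c *: u) v = hilbert_form_fun u (c^*%C *: v).
Proof.
rewrite /hilbert_form_fun linearZl_LR linearZr_LR /=; congr complex.Re.
by congr (_ * _); symmetry; exact: conjcK.
Qed.

Lemma rnormE u : `|u| = (rnorm u)%:C%C.
Proof. by rewrite /rnorm RRe_real// normr_real. Qed.

Lemma rnorm_ge0 u : 0 <= rnorm u.
Proof. by have := normr_ge0 u; rewrite rnormE ler0c. Qed.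

Lemma hilbert_formxx u : hilbert_form_fun u u = rnorm u ^+ 2.
Proof. by rewrite /hilbert_form_fun -hdot_normE rnormE -rmorphXn. Qed.

Fact hilbert_form_ge0 u : 0 <= hilbert_form_fun u u.
Proof. by rewrite hilbert_formxx sqr_ge0. Qed.

Definition hilbert_form : psd_form K :=
  PsdForm hilbert_formC hilbert_formDl hilbert_formZr hilbert_formZ
    hilbert_form_ge0.

Lemma psd_norm_hilbert u : psd_norm hilbert_form u = rnorm u.
Proof.
rewrite /psd_norm [hilbert_form _ _]hilbert_formxx sqrtr_sqr.
by rewrite ger0_norm ?rnorm_ge0.
Qed.

Lemma rnormD u v : rnorm (u + v) <= rnorm u + rnorm v.
Proof. by rewrite -!psd_norm_hilbert psd_normD. Qed.

Lemma rnormZ c u : rnorm (c *: u) = cmod c * rnorm u.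
Proof. by rewrite -!psd_norm_hilbert psd_normZ. Qed.

Lemma rnorm_eq0 u : rnorm u = 0 -> u = 0.
Proof. by move=> u0; apply/normr0_eq0; rewrite rnormE u0. Qed.

Lemma rnormB u v : rnorm (u - v) = rnorm (v - u).
Proof. by rewrite -!psd_norm_hilbert psd_normB. Qed.

(** A class of maps closed under sums, multiples and composition, and determined by values on a
    dense set: the axioms of a representation need checking only on matrices. *)
Definition lipschitz_map (F : K -> K) :=
  exists2 M : R, 0 <= M & forall u v, rnorm (F u - F v) <= M * rnorm (u - v).

Lemma lipschitz_map_linear (F : {linear K -> K}) (M : R) :
  0 <= M -> (forall u, rnorm (F u) <= M * rnorm u) -> lipschitz_map F.
Proof. by move=> M0 FM; exists M => // u v; rewrite -raddfB; exact: FM. Qed.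

Lemma lipschitz_map_id : lipschitz_map id.
Proof. by exists 1 => // u v; rewrite mul1r. Qed.

Lemma lipschitz_mapD F F' : lipschitz_map F -> lipschitz_map F' ->
  lipschitz_map (fun u => F u + F' u).
Proof.
move=> [M M0 FM] [M' M'0 F'M']; exists (M + M'); first exact: addr_ge0.
move=> u v; rewrite opprD addrACA mulrDl.
exact: le_trans (rnormD _ _) (lerD (FM _ _) (F'M' _ _)).
Qed.

Lemma lipschitz_mapZ c F : lipschitz_map F -> lipschitz_map (fun u => c *: F u).
Proof.
move=> [M M0 FM]; exists (cmod c * M); first by rewrite mulr_ge0 ?cmod_ge0.
by move=> u v; rewrite -scalerBr rnormZ -mulrA ler_wpM2l ?cmod_ge0.
Qed.

Lemma lipschitz_map_comp F F' : lipschitz_map F -> lipschitz_map F' ->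
  lipschitz_map (fun u => F (F' u)).
Proof.
move=> [M M0 FM] [M' M'0 F'M']; exists (M * M'); first exact: mulr_ge0.
move=> u v; rewrite (le_trans (FM _ _))// -mulrA ler_wpM2l//.
Qed.

Lemma lipschitz_map_dense (E : Type) (j : E -> K) F F' :
  (forall v (e : R), 0 < e -> exists x, rnorm (v - j x) <= e) ->
  lipschitz_map F -> lipschitz_map F' -> (forall x, F (j x) = F' (j x)) ->
  forall v, F v = F' v.
Proof.
move=> jd [M M0 FM] [M' M'0 F'M'] FF' v.
apply/eqP; rewrite -subr_eq0; apply/eqP/rnorm_eq0/le_anti.
rewrite rnorm_ge0 andbT; apply/ler_addgt0Pr => e e0; rewrite add0r.
have MM : 0 < M + M' + 1 by rewrite ltr_pwDr// addr_ge0.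
have [x vx] := jd v _ (divr_gt0 e0 MM).
have -> : F v - F' v = (F v - F (j x)) + (F' (j x) - F' v).
  by rewrite -FF' addrA subrK.
rewrite (le_trans (rnormD _ _))//.
apply: (@le_trans _ _ ((M + M') * rnorm (v - j x))).
  by rewrite mulrDl lerD// (le_trans (F'M' _ _))// rnormB.
apply: (@le_trans _ _ ((M + M' + 1) * (e / (M + M' + 1)))).
  by apply: ler_pM; rewrite ?rnorm_ge0 ?addr_ge0// lerDl.
by rewrite mulrC divfK// gt_eqF.
Qed.

End HilbertForm.

(** Compactness of [-M, M] gives a cluster point, and an ultrafilter converges to each of its
    cluster points. *)
Lemma ultra_bounded_cvg (R : realType) (T : Type) (U : set_system T)
    (f : T -> R) (M : R) :
  UltraFilter U -> (forall x, `|f x| <= M) -> cvg (f x @[x --> U]).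
Proof.
move=> UU fM.
have UM : (f x @[x --> U]) `[- M, M]%classic.
  change (U (f @^-1` `[- M, M]%classic)).
  by apply: filterE => x; rewrite /= in_itv/= -ler_norml fM.
have [p [_ pU]] := @segment_compact R (- M) M _ (fmap_proper_filter f _) UM.
apply/cvg_ex; exists p => A Ap.
have [//|UA] := in_ultra_setVsetC (f @^-1` A) UU.
by have [x []] := pU (~` A) A UA Ap.
Qed.

(** * The limit form on sequences of matrices *)

Section Representation.
Variables (R : realType) (G : nat -> finGroupType) (S : forall n, {set G n}).
Hypotheses (Sgen : forall n, <<S n>>%g = [set: G n]%SET)
           (Sfin : exists k, forall n, (#|S n| <= k)%N).
Local Notation X := {n : nat & G n}.
Local Notation C := R[i].
Local Notation matX := (X -> X -> C).
Local Notation d := (union_dist R S).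
Local Notation wl := (word_len (@Sgen _)).
Local Notation tg := (Tagged G).

Variables (U : set_system nat) (psi : forall n, G n -> G n -> R).
Hypotheses (UU : UltraFilter U) (U_infty : forall m, \forall n \near U, (m <= n)%N)
  (psiC : forall n (x y : G n), psi x y = psi y x)
  (psi_ge0 : forall n (x y : G n), 0 <= psi x y)
  (psi_local : forall m : nat, \forall n \near U, forall z : G n,
     exists (H : lmodType C) (b : psd_form H) (u : G n -> H), forall x y,
       (wl (z^-1 * x)%g <= m)%N -> (wl (z^-1 * y)%g <= m)%N ->
       psi x y = b (u x - u y) (u x - u y)).

Definition finprop : {pred nat -> matX} := fun a =>
  `[< (forall k, Cu d (a k)) /\
      exists k0, forall k, (k0 <= k)%N -> a k = fun _ _ => 0 >].

Lemma finprop_submod : submod_closed finprop.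
Proof.
split=> [|c a a' /asboolP[Ca [k0 a0]] /asboolP[Ca' [k0' a'0]]]; apply/asboolP; split.
- move=> k; apply/(CuP Sgen); exists 0, 0%N; split=> // [x y|n g h].
    by rewrite cmod0.
  by rewrite eqxx.
- by exists 0%N.
- by move=> k; apply: (CuD Sgen) => //; exact: CuZ.
- exists (maxn k0 k0') => k; rewrite geq_max => /andP[/a0 ak /a'0 a'k].
  apply/funext => x; apply/funext => y.
  by rewrite -[LHS]/(c * a k x y + a' k x y) ak a'k mulr0 addr0.
Qed.

HB.instance Definition _ :=
  GRing.isSubmodClosed.Build C (nat -> matX) finprop finprop_submod.

Record fpmat := FPmat { fpval :> nat -> matX; fpvalP : fpval \in finprop }.

HB.instance Definition _ := [isSub for fpval].
HB.instance Definition _ := [Choice of fpmat by <:].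
HB.instance Definition _ := [SubChoice_isSubLmodule of fpmat by <:].

Implicit Types a : fpmat.

Lemma fpmat_Cu a k : Cu d (a k).
Proof. by have /asboolP[] := fpvalP a. Qed.

Lemma fpmat_ext a a' : (forall k, a k = a' k) -> a = a'.
Proof. by move=> aa'; apply/val_inj/funext. Qed.

Lemma fpmatZE c a k x y : (c *: a : fpmat) k x y = c * a k x y. Proof. by []. Qed.

Lemma fpmat_unif a : exists (A : R) (k0 m : nat),
  [/\ 0 <= A, forall k, (k0 <= k)%N -> a k = fun _ _ => 0,
    forall k n (z : G n), \sum_(x : G n) cmod (a k (tg z) (tg x)) <= A &
    forall k n (z x : G n), a k (tg z) (tg x) != 0 -> (wl (z^-1 * x)%g <= m)%N].
Proof.
have /asboolP[Ca [k0 a0]] := fpvalP a.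
have /choice[A AP] k : exists A : R, 0 <= A /\
    forall n (z : G n), \sum_(x : G n) cmod (a k (tg z) (tg x)) <= A.
  by have [A A0 Ak] := Cu_row Sgen Sfin (Ca k); exists A.
have /choice[m mP] k : exists m : nat, forall n (z x : G n),
    a k (tg z) (tg x) != 0 -> (wl (z^-1 * x)%g <= m)%N.
  by have /(CuP Sgen)[_ [m [_ _ _ mP]]] := Ca k; exists m.
exists (\sum_(k < k0) A k), k0, (\sum_(k < k0) m k)%N; split=> //.
- by apply: sumr_ge0 => k _; case: (AP k).
- move=> k n z; have [kk0|/a0 ->] := ltnP k k0; last first.
    rewrite big1 ?sumr_ge0 => [//|k' _|x _]; [by case: (AP k')|exact: cmod0].
  rewrite (le_trans ((AP k).2 _ _))// (bigD1 (Ordinal kk0))//= lerDl.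
  by apply: sumr_ge0 => k' _; case: (AP k').
- move=> k n z x; have [kk0|/a0 ->] := ltnP k k0; last by rewrite eqxx.
  by move=> /mP /leq_trans; apply; rewrite (bigD1 (Ordinal kk0))//= leq_addr.
Qed.

(** The real part of c c'^*. *)
Definition redot (c c' : C) : R :=
  complex.Re c * complex.Re c' + complex.Im c * complex.Im c'.

Lemma redotC c c' : redot c c' = redot c' c.
Proof. by rewrite /redot mulrC [X in _ + X]mulrC. Qed.

Lemma redotDl c1 c2 c : redot (c1 + c2) c = redot c1 c + redot c2 c.
Proof. by case: c1 c2 c => ? ? [? ?] [? ?]; rewrite /redot/=; ring. Qed.

Lemma redotZr (r : R) c c' : redot (r%:C%C * c) c' = r * redot c c'.
Proof. by case: c c' => ? ? [? ?]; rewrite /redot/=; ring. Qed.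

Lemma redotZ e c c' : redot (e * c) c' = redot c (e^*%C * c').
Proof. by case: e c c' => ? ? [? ?] [? ?]; rewrite /redot/=; ring. Qed.

Lemma redot0l c : redot 0 c = 0. Proof. by rewrite /redot !mul0r addr0. Qed.
Lemma redot0r c : redot c 0 = 0. Proof. by rewrite redotC redot0l. Qed.

Lemma redot_le c c' : `|redot c c'| <= cmod c * cmod c'.
Proof.
rewrite -(@ler_pXn2r _ 2)// ?nnegrE ?mulr_ge0 ?cmod_ge0//.
rewrite real_normK ?num_real// exprMn !sqr_cmod -subr_ge0.
have -> : (complex.Re c ^+ 2 + complex.Im c ^+ 2) *
   (complex.Re c' ^+ 2 + complex.Im c' ^+ 2) - redot c c' ^+ 2 =
   (complex.Re c * complex.Im c' - complex.Im c * complex.Re c') ^+ 2.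
  by rewrite /redot; ring.
exact: sqr_ge0.
Qed.

Definition phi k n (x y : G n) : R := expR (- (k.+1%:R^-1 * psi x y)).

Lemma phiC k n (x y : G n) : phi k x y = phi k y x.
Proof. by rewrite /phi psiC. Qed.

Lemma phi_ge0 k n (x y : G n) : 0 <= phi k x y. Proof. exact: expR_ge0. Qed.

Lemma phi_le1 k n (x y : G n) : phi k x y <= 1.
Proof. by rewrite -expR0 ler_expR oppr_le0 mulr_ge0. Qed.

(** The real part of the inner product of sum_x v(x) e_x and sum_y v'(y) e_y, for the kernel <e_x,
    e_y> = phi_k(x,y). *)
Definition rowform k n (v v' : G n -> C) : R :=
  \sum_x \sum_y phi k x y * redot (v x) (v' y).

(* For finitely supported sequences the sum over [k < n] is the full sum as soon
   as [n] is large. *)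
Definition pform n (a a' : nat -> matX) : R := #|G n|%:R^-1 *
  \sum_(k < n) \sum_(z : G n) rowform k (fun x : G n => a k (tg z) (tg x))
                                        (fun y : G n => a' k (tg z) (tg y)).

Lemma rowformC k n (v v' : G n -> C) : rowform k v v' = rowform k v' v.
Proof.
rewrite /rowform exchange_big/=; apply: eq_bigr => y _; apply: eq_bigr => x _.
by rewrite phiC redotC.
Qed.

Lemma pformC n a a' : pform n a a' = pform n a' a.
Proof.
congr (_ * _); apply: eq_bigr => k _; apply: eq_bigr => z _; exact: rowformC.
Qed.

Lemma pformDl n a1 a2 a : pform n (a1 + a2 : fpmat) a = pform n a1 a + pform n a2 a.
Proof.
rewrite /pform -mulrDr -big_split/=; congr (_ * _); apply: eq_bigr => k _.
rewrite -big_split/=; apply: eq_bigr => z _; rewrite /rowform -big_split/=.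
apply: eq_bigr => x _; rewrite -big_split/=; apply: eq_bigr => y _.
by rewrite -mulrDr -redotDl.
Qed.

Lemma pformZr n (r : R) a a' : pform n (r%:C%C *: a : fpmat) a' = r * pform n a a'.
Proof.
rewrite /pform mulrCA; congr (_ * _); rewrite mulr_sumr; apply: eq_bigr => k _.
rewrite mulr_sumr; apply: eq_bigr => z _; rewrite /rowform mulr_sumr.
apply: eq_bigr => x _; rewrite mulr_sumr; apply: eq_bigr => y _.
by rewrite [RHS]mulrCA -[r * redot _ _]redotZr.
Qed.

Lemma pformZ n c a a' :
  pform n (c *: a : fpmat) a' = pform n a (c^*%C *: a' : fpmat).
Proof.
congr (_ * _); apply: eq_bigr => k _; apply: eq_bigr => z _.
by apply: eq_bigr => x _; apply: eq_bigr => y _; rewrite !fpmatZE redotZ.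
Qed.

Lemma rowform_bound k n (v v' : G n -> C) (theta : R) :
  (forall x y, v x != 0 -> v' y != 0 -> phi k x y <= theta) ->
  `|rowform k v v'| <= theta * ((\sum_x cmod (v x)) * (\sum_y cmod (v' y))).
Proof.
move=> vv'; rewrite (le_trans (ler_norm_sum _ _ _))// mulr_suml mulr_sumr.
apply: ler_sum => x _; rewrite (le_trans (ler_norm_sum _ _ _))// !mulr_sumr.
apply: ler_sum => y _; rewrite normrM (ger0_norm (phi_ge0 _ _ _)).
have [->|vx] := eqVneq (v x) 0.
  by rewrite redot0l normr0 mulr0 cmod0 mul0r mulr0.
have [->|v'y] := eqVneq (v' y) 0.
  by rewrite redot0r normr0 mulr0 cmod0 !mulr0.
by apply: ler_pM => //; [exact: phi_ge0|exact: vv'|exact: redot_le].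
Qed.

(** Used twice: theta = 1 gives the boundedness needed for the limit along [U], and a small theta
    gives near orthogonality. The factor 1/|G_n| absorbs the sum over rows, and [k0] counts the
    indices that contribute. *)
Lemma pform_bound (a a' : nat -> matX) (A A' theta : R) (k0 n : nat) :
  0 <= A -> 0 <= A' -> 0 <= theta ->
  (forall k, (k0 <= k)%N -> a' k = fun _ _ => 0) ->
  (forall k (z : G n), \sum_(x : G n) cmod (a k (tg z) (tg x)) <= A) ->
  (forall k (z : G n), \sum_(x : G n) cmod (a' k (tg z) (tg x)) <= A') ->
  (forall k (x y z : G n), a k (tg z) (tg x) != 0 -> a' k (tg z) (tg y) != 0 ->
     phi k x y <= theta) -> `|pform n a a'| <= k0%:R * (A * A') * theta.
Proof.
move=> A0 A'0 t0 a'0 rA rA' tP.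
have Gn0 : 0 < #|G n|%:R :> R by rewrite ltr0n (cardD1 1%g).
rewrite /pform normrM gtr0_norm ?invr_gt0// ler_pdivrMl//.
rewrite (le_trans (ler_norm_sum _ _ _))//.
have H (k : nat) : `|\sum_(z : G n) rowform k (fun x : G n => a k (tg z) (tg x))
      (fun y : G n => a' k (tg z) (tg y))| <=
      (k < k0)%N%:R * (#|G n|%:R * (theta * (A * A'))).
  have [kk0|/a'0 ->] := ltnP k k0; last first.
    rewrite mul0r big1 ?normr0// => z _; rewrite /rowform big1// => x _.
    by rewrite big1// => y _; rewrite redot0r mulr0.
  rewrite mul1r (le_trans (ler_norm_sum _ _ _))// mulr_natl -sumr_const.
  apply: ler_sum => z _.
  apply: le_trans (@rowform_bound k n _ _ theta (fun x y => tP k x y z)) _.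
  by rewrite ler_wpM2l// ler_pM// sumr_ge0// => *; exact: cmod_ge0.
apply: le_trans (ler_sum _ (fun (k : 'I_n) _ => H k)) _.
rewrite -mulr_suml.
have -> : k0%:R * (A * A') * theta = k0%:R * (theta * (A * A')) by ring.
rewrite (mulrCA _ k0%:R) ler_wpM2r ?mulr_ge0//.
rewrite -natr_sum ler_nat -(big_mkord xpredT (fun k => nat_of_bool (k < k0)%N)).
have [nk0|nk0] := leqP n k0.
  apply: leq_trans (leq_sum _ (fun i _ => leq_b1 _)) _.
  by rewrite sum_nat_const_nat subn0 muln1.
rewrite (big_cat_nat _ (n := k0))//=; last exact: ltnW.
rewrite [X in (_ + X)%N]big_nat_cond [X in (_ + X)%N]big1 ?addn0 => [|k].
  apply: leq_trans (leq_sum _ (fun i _ => leq_b1 _)) _.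
  by rewrite sum_nat_const_nat subn0 muln1.
by rewrite andbT => /andP[k0k _]; rewrite ltnNge k0k.
Qed.

Lemma pform_cvg a a' : cvg (pform n a a' @[n --> U]).
Proof.
have [A [_ [_ [A0 _ rA _]]]] := fpmat_unif a.
have [A' [k0 [_ [A'0 a'0 rA' _]]]] := fpmat_unif a'.
apply: (@ultra_bounded_cvg _ _ _ _ (k0%:R * (A * A') * 1)) => n.
by apply: pform_bound => // k x y z _ _; exact: phi_le1.
Qed.

(** A row supported in the m-ball about z sees [psi] only where it is a squared Hilbert distance. As
    phi_k is real and symmetric, the form splits into those of the real and imaginary parts of the
    row. *)
Lemma rowform_ge0 m : \forall n \near U, forall k (z : G n) (v : G n -> C),
  (forall x, v x != 0 -> (wl (z^-1 * x)%g <= m)%N) -> 0 <= rowform k v v.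
Proof.
near=> n; move=> k z v vm.
have : forall z : G n, exists (H : lmodType C) (b : psd_form H) (u : G n -> H),
    forall x y, (wl (z^-1 * x)%g <= m)%N -> (wl (z^-1 * y)%g <= m)%N ->
    psi x y = b (u x - u y) (u x - u y) by near: n; exact: psi_local.
move=> /(_ z)[H [b [u psiE]]].
have k0 : 0 <= k.+1%:R^-1 :> R by rewrite invr_ge0.
have [_ phi_psd] := psd_kernel_gauss b u k0.
have -> : rowform k v v = \sum_x \sum_y complex.Re (v x) * complex.Re (v y) *
    expR (- (k.+1%:R^-1 * b (u x - u y) (u x - u y))) +
    \sum_x \sum_y complex.Im (v x) * complex.Im (v y) *
    expR (- (k.+1%:R^-1 * b (u x - u y) (u x - u y))).
  rewrite -big_split/=; apply: eq_bigr => x _; rewrite -big_split/=.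
  apply: eq_bigr => y _; rewrite -mulrDl [RHS]mulrC.
  have [->|/vm vx] := eqVneq (v x) 0; first by rewrite redot0l !mul0r addr0 !mulr0.
  have [->|/vm vy] := eqVneq (v y) 0; first by rewrite redot0r !mulr0 addr0 !mulr0.
  by rewrite /phi psiE.
exact: addr_ge0.
Unshelve. all: by end_near. Qed.

Lemma pform_ge0 a : \forall n \near U, 0 <= pform n a a.
Proof.
have [_ [_ [m [_ _ _ am]]]] := fpmat_unif a.
near=> n; rewrite /pform mulr_ge0 ?invr_ge0//.
apply: sumr_ge0 => k _; apply: sumr_ge0 => z _.
have H : forall k (z : G n) (v : G n -> C),
  (forall x, v x != 0 -> (wl (z^-1 * x)%g <= m)%N) -> 0 <= rowform k v v.
  by near: n; exact: rowform_ge0.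
by apply: (H k z) => x; exact: am.
Unshelve. all: by end_near. Qed.

Definition mean_form_fun a a' : R := lim (pform n a a' @[n --> U]).

Lemma mean_form_cvg a a' : pform n a a' @[n --> U] --> mean_form_fun a a'.
Proof. exact: pform_cvg. Qed.

Lemma mean_form_lim a a' (l : R) : pform n a a' @[n --> U] --> l ->
  mean_form_fun a a' = l.
Proof.
by move=> h; exact: (cvg_lim _ h).
Qed.

Fact mean_formC a a' : mean_form_fun a a' = mean_form_fun a' a.
Proof.
apply: mean_form_lim; under eq_fun do rewrite pformC; exact: mean_form_cvg.
Qed.

Fact mean_formDl a a' a'' : mean_form_fun (a + a') a'' =
  mean_form_fun a a'' + mean_form_fun a' a''.
Proof.
apply: mean_form_lim; under eq_fun do rewrite pformDl.
by apply: cvgD; exact: mean_form_cvg.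
Qed.

Fact mean_formZr (r : R) a a' : mean_form_fun (r%:C%C *: a) a' =
  r * mean_form_fun a a'.
Proof.
apply: mean_form_lim; under eq_fun do rewrite pformZr.
by apply: cvgM; [exact: cvg_cst|exact: mean_form_cvg].
Qed.

Fact mean_formZ c a a' : mean_form_fun (c *: a) a' = mean_form_fun a (c^*%C *: a').
Proof.
apply: mean_form_lim; under eq_fun do rewrite pformZ.
exact: mean_form_cvg.
Qed.

Lemma mean_form_le (r s : R) a1 a2 a3 a4 :
  (\forall n \near U, r * pform n a1 a2 <= s * pform n a3 a4) ->
  r * mean_form_fun a1 a2 <= s * mean_form_fun a3 a4.
Proof.
apply: ler_cvg_to; apply: cvgM; do ?exact: cvg_cst; exact: mean_form_cvg.
Qed.

Fact mean_form_ge0 a : 0 <= mean_form_fun a a.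
Proof.
have := @mean_form_le 0 1 a a a a; rewrite mul0r mul1r; apply.
by apply: filterS (pform_ge0 a) => n; rewrite mul0r mul1r.
Qed.

Definition mean_form : psd_form fpmat :=
  PsdForm mean_formC mean_formDl mean_formZr mean_formZ mean_form_ge0.

Lemma mean_form_upper a a' (s : R) :
  (\forall n \near U, pform n a a' <= s) -> mean_form a a' <= s.
Proof.
by apply: ler_cvg_to; [exact: mean_form_cvg|exact: cvg_cst].
Qed.

Lemma fpact_subproof T (CT : Cu d T) a : (fun k => mmul T (a k)) \in finprop.
Proof.
have /asboolP[Ca [k0 a0]] := fpvalP a; apply/asboolP; split.
  by move=> k; exact: (CuM Sgen).
by exists k0 => k /a0 ->; exact: mmul0r Sgen _ CT.
Qed.

Definition fpact T (CT : Cu d T) a := FPmat (fpact_subproof CT a).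

Lemma fpact_is_linear T (CT : Cu d T) : linear (fpact CT).
Proof.
move=> c a a'; apply: fpmat_ext => k.
rewrite -[RHS]/(fun x y => c * mmul T (a k) x y + mmul T (a' k) x y).
rewrite -[LHS]/(mmul T (fun x y => c * a k x y + a' k x y)).
by rewrite (mmulDr Sgen)// (mmulZr Sgen).
Qed.

HB.instance Definition _ T (CT : Cu d T) :=
  GRing.isLinear.Build C fpmat fpmat *:%R (fpact CT) (fpact_is_linear CT).

Lemma rowformZ k n c (v : G n -> C) :
  rowform k (fun x => c * v x) (fun x => c * v x) = cmod c ^+ 2 * rowform k v v.
Proof.
rewrite /rowform mulr_sumr; apply: eq_bigr => x _; rewrite mulr_sumr.
apply: eq_bigr => y _; rewrite mulrCA; congr (_ * _); rewrite sqr_cmod.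
by case: c (v x) (v y) => ? ? [? ?] [? ?]; rewrite /redot/=; ring.
Qed.

Lemma rowform0 k n : rowform k (fun _ : G n => 0) (fun _ => 0) = 0.
Proof. by rewrite /rowform big1// => x _; rewrite big1// => y _; rewrite redot0l mulr0. Qed.

Definition pt_entry (V : matX) n (z h : G n) : R := (V (tg z) (tg h) != 0)%:R.

Lemma pt_entry_row (V : matX) n (F : G n -> R) (z : G n) :
  partial_translation d V ->
  (exists2 h : G n, V (tg z) (tg h) = 1 &
     (forall l : G n, l != h -> V (tg z) (tg l) = 0) /\
     \sum_h pt_entry V z h * F h = F h) \/
  ((forall l : G n, V (tg z) (tg l) = 0) /\ \sum_h pt_entry V z h * F h = 0).
Proof.
move=> [CV V01 Vr Vc].
have [[h Vh]|nh] := pselect (exists h : G n, V (tg z) (tg h) != 0).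
  left; exists h; first by case: (V01 (tg z) (tg h)) Vh => // ->; rewrite eqxx.
  have V0 (l : G n) : l != h -> V (tg z) (tg l) = 0.
    move=> lh; apply/eqP/negPn/negP => Vl; case/eqP: lh.
    by have /eqP := Vr _ _ _ Vl Vh; rewrite Tagged_eqE => /eqP.
  split=> //; rewrite (bigD1 h)//= /pt_entry Vh mul1r big1 ?addr0// => l /V0 ->.
  by rewrite eqxx mul0r.
right; have V0 (l : G n) : V (tg z) (tg l) = 0.
  by apply/eqP/negPn/negP => Vl; apply: nh; exists l.
by split=> //; rewrite big1// => l _; rewrite /pt_entry V0 eqxx mul0r.
Qed.

Lemma pt_entry_col (V : matX) n (h : G n) : partial_translation d V ->
  \sum_z pt_entry V z h <= 1.
Proof.
move=> [CV V01 Vr Vc].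
have [[z Vz]|nz] := pselect (exists z : G n, V (tg z) (tg h) != 0).
  rewrite (bigD1 z)//= /pt_entry Vz big1 ?addr0// => l lz.
  have [Vl|] := boolP (V (tg l) (tg h) != 0) => //; case/eqP: lz.
  by have /eqP := Vc _ _ _ Vl Vz; rewrite Tagged_eqE => /eqP.
rewrite big1// => z _; rewrite /pt_entry.
by have [Vz|] := boolP (V (tg z) (tg h) != 0) => //; case: nz; exists z.
Qed.

Lemma Cu_weighted (f : X -> C) (V : matX) : ell_infty f -> Cu d V ->
  Cu d (fun x y => f x * V x y).
Proof.
move=> fb CV; rewrite -(mmul_diag Sgen V fb).
by apply: (CuM Sgen Sfin) => //; exact: (Cu_diag Sgen).
Qed.

(** Row z of the product is f(z) times the row h of a with V(z,h) = 1, or zero. No h serves two rows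
    z, and the rows of a that are not reached may be added back because their forms are
    nonnegative. *)
Lemma pform_weighted (f : X -> C) V (CW : Cu d (fun x y => f x * V x y)) a :
  ell_infty f -> partial_translation d V ->
  \forall n \near U,
  pform n (fpact CW a) (fpact CW a) <= sup_norm f ^+ 2 * pform n a a.
Proof.
move=> fb ptV; have [_ [_ [m [_ _ _ am]]]] := fpmat_unif a.
near=> n.
have H : forall k (z : G n) (v : G n -> C),
  (forall x, v x != 0 -> (wl (z^-1 * x)%g <= m)%N) -> 0 <= rowform k v v.
  by near: n; exact: rowform_ge0.
rewrite /pform mulrCA; apply: ler_wpM2l; first by rewrite invr_ge0.
rewrite mulr_sumr; apply: ler_sum => k _.
pose q (h : G n) := rowform k (fun x : G n => a k (tg h) (tg x))
  (fun y : G n => a k (tg h) (tg y)).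
have q0 h : 0 <= q h by apply: (H k h) => x; exact: am.
have rowE (z : G n) : rowform k (fun x : G n => fpact CW a k (tg z) (tg x))
    (fun x : G n => fpact CW a k (tg z) (tg x)) =
    cmod (f (tg z)) ^+ 2 * \sum_h pt_entry V z h * q h.
  have WE (x : G n) : fpact CW a k (tg z) (tg x) =
      \sum_(h : G n) f (tg z) * V (tg z) (tg h) * a k (tg h) (tg x).
    by rewrite -(mmulE Sgen _ _ _ CW).
  case: (pt_entry_row q z ptV) => [[h Vh [V0 ->]]|[V0 ->]].
    rewrite -rowformZ; congr rowform; apply/funext => x; rewrite WE (bigD1 h)//=;
    by rewrite Vh mulr1 big1 ?addr0// => l /V0 ->; rewrite mulr0 mul0r.
  rewrite mulr0 -(rowform0 k n); congr rowform; apply/funext => x; rewrite WE big1//;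
  by move=> l _; rewrite V0 mulr0 mul0r.
under eq_bigr do rewrite rowE.
apply: (@le_trans _ _ (\sum_(z : G n) \sum_h
    sup_norm f ^+ 2 * (pt_entry V z h * q h))).
  apply: ler_sum => z _; rewrite mulr_sumr; apply: ler_sum => h _.
  rewrite ler_wpM2r ?mulr_ge0//.
  by rewrite ler_pXn2r ?nnegrE ?cmod_ge0 ?sup_norm_ge0// le_sup_norm.
rewrite exchange_big/= mulr_sumr; apply: ler_sum => h _.
rewrite -mulr_sumr ler_wpM2l ?sqr_ge0// -mulr_suml.
by rewrite ler_piMl// pt_entry_col.
Unshelve. all: by end_near. Qed.

Lemma fpactE T (CT : Cu d T) a k n (g : G n) y :
  fpact CT a k (tg g) y = \sum_(h : G n) T (tg g) (tg h) * a k (tg h) y.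
Proof. exact: (mmulE Sgen). Qed.

Lemma psd_norm_le_sqr (E : lmodType C) (b : psd_form E) x y (s : R) : 0 <= s ->
  b x x <= s ^+ 2 * b y y -> psd_norm b x <= s * psd_norm b y.
Proof.
move=> s0; rewrite -!(sqr_psd_norm b) -exprMn.
by rewrite ler_pXn2r// ?nnegrE ?mulr_ge0 ?psd_norm_ge0.
Qed.

Lemma fpact_weighted (f : X -> C) V (CW : Cu d (fun x y => f x * V x y)) a :
  ell_infty f -> partial_translation d V ->
  psd_norm mean_form (fpact CW a) <= sup_norm f * psd_norm mean_form a.
Proof.
move=> fb ptV; apply: psd_norm_le_sqr; first exact: sup_norm_ge0.
have := @mean_form_le 1 (sup_norm f ^+ 2) (fpact CW a) (fpact CW a) a a.
rewrite mul1r; apply; apply: filterS (pform_weighted CW a fb ptV) => n.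
by rewrite mul1r.
Qed.

Lemma fpact_pt V (CV : Cu d V) a : partial_translation d V ->
  psd_norm mean_form (fpact CV a) <= 1 * psd_norm mean_form a.
Proof.
move=> ptV; pose f (x : X) : C := 1.
have fb : ell_infty f := @ell_infty1 R G.
have CW : Cu d (fun x y => f x * V x y) by exact: Cu_weighted.
have -> : fpact CV a = fpact CW a.
  have VE : V = fun x y => f x * V x y.
    by apply/funext => x; apply/funext => y; rewrite mul1r.
  apply: fpmat_ext => k.
  by rewrite -[LHS]/(mmul V (a k)) -[RHS]/(mmul (fun x y => f x * V x y) (a k)) -VE.
apply: le_trans (fpact_weighted CW a fb ptV) _; rewrite ler_wpM2r ?psd_norm_ge0//.
apply: ge_sup; first by exists (cmod (f (tg (1%g : G 0%N)))), (tg (1%g : G 0%N)).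
by move=> _ [x _ <-]; rewrite -/(cmod _) cmod1.
Qed.

Lemma psd_norm_sum (E : lmodType C) (b : psd_form E) N (x : 'I_N -> E) :
  psd_norm b (\sum_i x i) <= \sum_i psd_norm b (x i).
Proof.
elim/big_ind2 : _ => [|u r v s ur vs|//]; first by rewrite /psd_norm psd0l sqrtr0.
exact: le_trans (psd_normD _ _ _) (lerD ur vs).
Qed.

Lemma fpmat_sumE N (x : 'I_N -> fpmat) k p q :
  (\sum_i x i : fpmat) k p q = \sum_i x i k p q.
Proof. by apply: (big_morph (fun a : fpmat => a k p q)). Qed.

Lemma fpact_decomposition T (CT : Cu d T) a N (f : 'I_N -> X -> C)
    (V : 'I_N -> matX) :
  (forall i, ell_infty (f i)) -> (forall i, partial_translation d (V i)) ->
  (forall x y, T x y = \sum_(i < N) f i x * V i x y) ->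
  psd_norm mean_form (fpact CT a) <=
    (\sum_(i < N) sup_norm (f i)) * psd_norm mean_form a.
Proof.
move=> fb ptV TE.
have CW i : Cu d (fun x y => f i x * V i x y).
  by apply: Cu_weighted => //; case: (ptV i).
have -> : fpact CT a = \sum_i fpact (CW i) a.
  apply: fpmat_ext => k; apply/funext => -[n g]; apply/funext => y.
  rewrite fpmat_sumE fpactE.
  under [RHS]eq_bigr do rewrite fpactE.
  rewrite exchange_big/=; apply: eq_bigr => h _.
  by rewrite TE mulr_suml.
apply: le_trans (psd_norm_sum _ _) _; rewrite mulr_suml.
by apply: ler_sum => i _; exact: fpact_weighted.
Qed.

(** Every decomposition of T bounds the operator by its cost; after division by the norm of a, the
    infimum over decompositions may be taken. Vectors of norm zero are treated apart. *)
Lemma fpact_l1 T (CT : Cu d T) : 0 <= l1_norm d T /\ forall a,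
  psd_norm mean_form (fpact CT a) <= l1_norm d T * psd_norm mean_form a.
Proof.
have [N [f [V [fb ptV TE]]]] := Cu_decomposition Sgen Sfin CT.
split=> [|a].
  apply: lb_le_inf; first by exists (\sum_(i < N) sup_norm (f i)), N, f, V.
  by move=> _ [N' [f' [V' [fb' _ _ ->]]]]; apply: sumr_ge0 => i _; exact: sup_norm_ge0.
have [a0|a0] := eqVneq (psd_norm mean_form a) 0.
  by have := fpact_decomposition CT a fb ptV TE; rewrite a0 !mulr0.
have {}a0 : 0 < psd_norm mean_form a by rewrite lt_def a0 psd_norm_ge0.
rewrite -ler_pdivrMr//.
apply: lb_le_inf; first by exists (\sum_(i < N) sup_norm (f i)), N, f, V.
move=> _ [N' [f' [V' [fb' ptV' TE' ->]]]]; rewrite ler_pdivrMr//.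
exact: fpact_decomposition.
Qed.

(** * Operators on the completion *)

Section Operators.
Variables (K : hilbertType R) (j : {linear fpmat -> K}).
Hypotheses (jE : forall a a', complex.Re (hdot (j a) (j a')) = mean_form a a')
  (j_dense : forall v (e : R), 0 < e -> exists a, rnorm (v - j a) <= e)
  (j_ext : forall (A : {linear fpmat -> fpmat}) (M : R), 0 <= M ->
    (forall a, psd_norm mean_form (A a) <= M * psd_norm mean_form a) ->
    exists L : {linear K -> K}, (forall a, L (j a) = j (A a)) /\
    (forall M', 0 <= M' -> (forall a, psd_norm mean_form (A a) <=
       M' * psd_norm mean_form a) -> forall u, rnorm (L u) <= M' * rnorm u)).

Lemma rnorm_j a : rnorm (j a) = psd_norm mean_form a.
Proof.
rewrite -psd_norm_hilbert /psd_norm; congr Num.sqrt; exact: jE.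
Qed.

(** A representation is a total function on matrices; outside [Cu] the identity is the default
    value. *)
Lemma operator_ex T : exists L : {linear K -> K}, forall CT : Cu d T,
  (forall a, L (j a) = j (fpact CT a)) /\
  (forall M', 0 <= M' -> (forall a, psd_norm mean_form (fpact CT a) <=
       M' * psd_norm mean_form a) -> forall u, rnorm (L u) <= M' * rnorm u).
Proof.
have [CT|nCT] := pselect (Cu d T); last by exists idfun.
have [l0 lT] := fpact_l1 CT; have [L [Lj LM]] := j_ext l0 lT.
by exists L => CT'; rewrite (Prop_irrelevance CT' CT).
Qed.

Definition oprep T : {linear K -> K} := projT1 (cid (operator_ex T)).

Lemma oprepE T (CT : Cu d T) a : oprep T (j a) = j (fpact CT a).
Proof. by rewrite /oprep; case: cid => L /= /(_ CT)[]. Qed.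

Lemma oprep_bound T (CT : Cu d T) M : 0 <= M ->
  (forall a, psd_norm mean_form (fpact CT a) <= M * psd_norm mean_form a) ->
  forall u, rnorm (oprep T u) <= M * rnorm u.
Proof. by rewrite /oprep; case: cid => L /= /(_ CT)[_]; exact. Qed.

Lemma oprep_lipschitz T : Cu d T -> lipschitz_map (oprep T).
Proof.
move=> CT; have [l0 lT] := fpact_l1 CT.
exact: lipschitz_map_linear l0 (oprep_bound l0 lT).
Qed.

Lemma oprep_representation : representation d oprep.
Proof.
split.
- apply: (lipschitz_map_dense j_dense) => [||a].
  + exact/oprep_lipschitz/Cu1.
  + exact: lipschitz_map_id.
  + rewrite (oprepE (Cu1 R Sgen)); congr (j _); apply: fpmat_ext => k.
    exact: (mmul1l Sgen).
- move=> T T' CT CT'; apply: (lipschitz_map_dense j_dense) => [||a].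
  + exact/oprep_lipschitz/CuD.
  + by apply: lipschitz_mapD; exact: oprep_lipschitz.
  + rewrite (oprepE CT) (oprepE CT') (oprepE (CuD Sgen CT CT')) -raddfD.
    congr (j _); apply: fpmat_ext => k.
    exact: (mmulDl Sgen Sfin CT CT' (fpmat_Cu a k)).
- move=> c T CT; apply: (lipschitz_map_dense j_dense) => [||a].
  + exact/oprep_lipschitz/CuZ.
  + by apply: lipschitz_mapZ; exact: oprep_lipschitz.
  + rewrite (oprepE CT) (oprepE (CuZ Sgen c CT)) -linearZ.
    congr (j _); apply: fpmat_ext => k.
    exact: (mmulZl Sgen _ c CT).
- move=> T T' CT CT'; apply: (lipschitz_map_dense j_dense) => [||a].
  + exact/oprep_lipschitz/CuM.
  + by apply: lipschitz_map_comp; exact: oprep_lipschitz.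
  + rewrite (oprepE CT') (oprepE CT) (oprepE (CuM Sgen Sfin CT CT')).
    congr (j _); apply: fpmat_ext => k.
    exact: (mmulA Sgen Sfin _ CT CT').
- by move=> T CT; have [l0 lT] := fpact_l1 CT; exact: oprep_bound l0 lT.
Qed.

(** If V fixes eta, then |eta|^2 = <V eta, eta>. Replacing eta by the nearby [j a] in the first and
    then the second place costs the two error terms and leaves <V a, a>. *)
Lemma oprep_mixing_bound V (CV : Cu d V) a (eta : K) (e s : R) :
  partial_translation d V -> oprep V eta = eta -> rnorm (eta - j a) <= e ->
  mean_form (fpact CV a) a <= s ->
  rnorm eta ^+ 2 <= e * rnorm eta + (rnorm eta + e) * e + s.
Proof.
move=> ptV Veta eta_a Vas.
have V1 := oprep_bound ler01 (fun b => fpact_pt CV b ptV).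
have e0 : 0 <= e := le_trans (rnorm_ge0 _) eta_a.
have ja : rnorm (j a) <= rnorm eta + e.
  rewrite -[j a](subrK eta) addrC (le_trans (rnormD _ _))// lerD2l rnormB//.
have cs u v : hilbert_form K u v <= rnorm u * rnorm v.
  by rewrite -!psd_norm_hilbert (le_trans (ler_norm _))// psd_CauchySchwarz.
have -> : rnorm eta ^+ 2 = hilbert_form K (oprep V (eta - j a)) eta +
    hilbert_form K (oprep V (j a)) (eta - j a) + mean_form (fpact CV a) a.
  rewrite -jE -(oprepE CV) -[complex.Re _]/(hilbert_form K (oprep V (j a)) (j a)).
  rewrite -addrA -psdDr subrK -psdDl.
  rewrite (_ : oprep V (eta - j a) + oprep V (j a) = eta); last first.
    by rewrite -raddfD subrK.
  by rewrite -[RHS]/(hilbert_form_fun eta eta) hilbert_formxx.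
apply: lerD => //; apply: lerD; apply: le_trans (cs _ _) _.
  by apply: ler_wpM2r; rewrite ?rnorm_ge0// (le_trans (V1 _))// mul1r.
apply: ler_pM; rewrite ?rnorm_ge0// (le_trans (V1 _))// mul1r//.
Qed.

Lemma oprep_no_invariant
  (psi_mix : forall (B : R) (m : nat), exists r : nat, \forall n \near U,
     exists2 g : G n, (wl g <= r)%N & forall x y z : G n,
     (wl ((z * g)^-1 * x)%g <= m)%N -> (wl (z^-1 * y)%g <= m)%N -> B <= psi x y)
  (eta : K) : invariant_vectors d oprep eta -> eta = 0.
Proof.
move=> eta_inv; apply/eqP/negPn/negP => eta_neq0.
have h0 : 0 < rnorm eta.
  by rewrite lt_def rnorm_ge0 andbT; apply: contra_neq eta_neq0; exact: rnorm_eq0.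
set h := rnorm eta in h0 *.
(* With e = h/8 the approximation errors total 17/64 h^2; together with h^2/4 for the mixing term
   this is 33/64 h^2, less than h^2. *)
have [a eta_a] := j_dense eta (divr_gt0 h0 (ltr0n R 8)).
have [A [k0 [m [A0 a0 rA am]]]] := fpmat_unif a.
(* The target for the kernel phi_k: the bound k0 A^2 delta is at most h^2/4. The added 1 keeps the
   denominator positive. *)
pose delta := h ^+ 2 / 4 / (k0%:R * (A * A) + 1).
have kA0 : 0 <= k0%:R * (A * A) by rewrite !mulr_ge0.
have d0 : 0 < delta by rewrite !divr_gt0 ?exprn_gt0// ltr_pwDr.
(* Only k < k0 contribute, so k + 1 <= k0 and psi >= k0/delta gives psi/(k+1) >= 1/delta; then phi_k
   <= delta because exp(x) >= 1 + x. *)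
have [r mixr] := psi_mix (k0%:R * delta^-1) m.
pose mixing n (g : G n) := forall x y z : G n,
  (wl ((z * g)^-1 * x)%g <= m)%N -> (wl (z^-1 * y)%g <= m)%N ->
  k0%:R * delta^-1 <= psi x y.
have [w [wr wmix]] : exists w : forall n, G n, (forall n, (wl (w n) <= r)%N) /\
    \forall n \near U, mixing n (w n).
  (* Where no mixing element of length at most r exists, the unit is taken, so that the length bound
     holds for all n and V lies in C_u[X]. *)
  have wP n : exists g : G n, (wl g <= r)%N /\
      ((exists2 g : G n, (wl g <= r)%N & mixing n g) -> mixing n g).
    have [[g gr gm]|ng] := pselect (exists2 g : G n, (wl g <= r)%N & mixing n g).
      by exists g.
    by exists 1%g; rewrite word_len1.
  exists (fun n => projT1 (cid (wP n))); split=> [n|]; first by case: cid => g [].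
  by apply: filterS mixr => n; case: cid => g /= [_]; exact.
pose V : matX := right_translation R xpredT w.
have ptV : partial_translation d V.
  by apply: (@right_translationP _ _ _ Sgen _ _ r) => n _; exact: wr.
have CV : Cu d V by case: ptV.
have Veta : oprep V eta = eta.
  rewrite (eta_inv _ ptV) right_translation_range chi_setT.
  by have [-> _ _ _ _] := oprep_representation.
have Va k n (z : G n) y : fpact CV a k (tg z) y = a k (tg (z * w n)%g) y.
  rewrite fpactE (bigD1 (z * w n)%g)//= /V right_translation_Tagged eqxx mul1r.
  rewrite big1 ?addr0// => l lz.
  by rewrite right_translation_Tagged/= (negPf lz) mul0r.
have Vas : mean_form (fpact CV a) a <= k0%:R * (A * A) * delta.
  apply: mean_form_upper; apply: filterS wmix => n mixn.
  apply: le_trans (ler_norm _) _; apply: pform_bound => //.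
  - exact: ltW.
  - move=> k z; under eq_bigr do rewrite Va; exact: rA.
  - move=> k x y z; rewrite Va => /am zx azy; have /am zy := azy.
    have kk0 : (k < k0)%N.
      by rewrite ltnNge; apply: contra azy => /a0 ->.
    have psi_xy := mixn x y z zx zy.
    have k1 : 0 < k.+1%:R :> R by rewrite ltr0n.
    have dV : delta^-1 <= k.+1%:R^-1 * psi x y.
      rewrite ler_pdivlMl// (le_trans _ psi_xy)// ler_wpM2r ?invr_ge0 ?(ltW d0)//.
      by rewrite ler_nat.
    rewrite /phi expRN invf_ple ?posrE ?expR_gt0//.
    apply: le_trans dV _; apply: le_trans (expR_ge1Dx _).
    by rewrite lerDr.
have := oprep_mixing_bound ptV Veta eta_a Vas; rewrite -/h => hh.
have dE : k0%:R * (A * A) * delta <= h ^+ 2 / 4.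
  rewrite /delta mulrA ler_pdivrMr ?ltr_pwDr//.
  by rewrite mulrC; apply: ler_wpM2l; [rewrite divr_ge0// sqr_ge0|rewrite lerDl].
have h2 : 0 < h ^+ 2 by rewrite exprn_gt0.
have : h ^+ 2 <= h / 8 * h + (h + h / 8) * (h / 8) + h ^+ 2 / 4.
  exact: le_trans hh (lerD (lexx _) dE).
have -> : h / 8 * h + (h + h / 8) * (h / 8) + h ^+ 2 / 4 = 33 / 64 * h ^+ 2 by field.
by rewrite -{1}[h ^+ 2]mul1r ler_pM2r// ler_pdivlMr// mul1r ler_nat.
Qed.

(** * Almost invariant unit vectors *)

Lemma basis_fp_subproof (k : nat) :
  (fun k' => if k' == k then @mone R _ else fun _ _ => 0 : C) \in finprop.
Proof.
apply/asboolP; split=> [k'|].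
  case: eqP => _; first exact: (Cu1 R Sgen).
  apply/(CuP Sgen); exists 0, 0%N; split=> // [x y|n g h]; first by rewrite cmod0.
  by rewrite eqxx.
by exists k.+1 => k'; case: eqP => [->|//]; rewrite ltnn.
Qed.

Definition basis_fp k := FPmat (basis_fp_subproof k).

Lemma basis_fpE k k' n (z x : G n) :
  basis_fp k k' (tg z) (tg x) = ((k' == k) && (x == z))%:R.
Proof.
rewrite /basis_fp/=; case: eqP => //= _.
by rewrite /mone /mdiag Tagged_eqE eq_sym; case: eqP.
Qed.

Lemma pform_single n k0 a : (k0 < n)%N ->
  (forall k (z x : G n), k != k0 -> a k (tg z) (tg x) = 0) ->
  pform n a a = #|G n|%:R^-1 * \sum_(z : G n)
    rowform k0 (fun x : G n => a k0 (tg z) (tg x))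
               (fun x : G n => a k0 (tg z) (tg x)).
Proof.
move=> k0n a0; rewrite /pform; congr (_ * _).
rewrite (bigD1 (Ordinal k0n))//= [X in _ + X]big1 ?addr0// => k kk0.
rewrite big1// => z _; rewrite -(rowform0 k n).
by congr rowform; apply/funext => x; rewrite a0.
Qed.

Lemma rowform_real k n (c : G n -> R) (v : G n -> C) :
  (forall x, v x = (c x)%:C%C) ->
  rowform k v v = \sum_x \sum_y c x * c y * phi k x y.
Proof.
move=> vE; rewrite /rowform; apply: eq_bigr => x _; apply: eq_bigr => y _.
by rewrite !vE /redot/= mulr0 addr0 mulrC.
Qed.

Lemma phi_diag k : \forall n \near U, forall z : G n, phi k z z = 1.
Proof.
apply: filterS (psi_local 0) => n H z; have [H' [b [u psiE]]] := H z.
rewrite /phi psiE ?mulVg ?word_len1// subrr psd0l mulr0 oppr0; exact: expR0.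
Qed.

Lemma natrC (b : nat) : (b%:R : C) = (b%:R : R)%:C%C.
Proof. by rewrite rmorph_nat. Qed.

Lemma phi_delta k n (h : G n) :
  \sum_i \sum_j (i == h)%:R * (j == h)%:R * phi k i j = phi k h h.
Proof.
under eq_bigr do under eq_bigr do rewrite -mulrA.
under eq_bigr do rewrite -mulr_sumr sum_delta_mul.
by rewrite sum_delta_mul.
Qed.

Lemma basis_fp_norm k : mean_form (basis_fp k) (basis_fp k) = 1.
Proof.
apply: mean_form_lim; apply: cvg_near_cst.
near=> n.
have kn : (k < n)%N by near: n; exact: U_infty.
have phi1 : forall z : G n, phi k z z = 1 by near: n; exact: phi_diag.
rewrite (pform_single kn) => [|k' z x /negPf kk']; last by rewrite basis_fpE kk'.
rewrite (eq_bigr (fun _ => 1)) => [|z _]; last first.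
  rewrite (@rowform_real _ _ (fun x => (x == z)%:R)) ?phi_delta ?phi1// => x.
  by rewrite basis_fpE eqxx/= natrC.
rewrite sumr_const mulVf// pnatr_eq0 -lt0n (cardD1 1%g)//.
Unshelve. all: by end_near. Qed.

Lemma chi_Cu A : Cu d (chi R A).
Proof.
apply: (Cu_diag Sgen); exists 1 => x; rewrite -/(cmod _).
by case: asboolP => _; rewrite ?cmod1 ?cmod0.
Qed.

Definition displacement V (CV : Cu d V) k : fpmat :=
  fpact CV (basis_fp k) - fpact (chi_Cu (mrange V)) (basis_fp k).

Lemma displacementE V (CV : Cu d V) k k' n (z x : G n) :
  displacement CV k k' (tg z) (tg x) =
  (k' == k)%:R * (V (tg z) (tg x) - `[< mrange V (tg z) >]%:R * (x == z)%:R).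
Proof.
have E T (CT : Cu d T) : fpact CT (basis_fp k) k' (tg z) (tg x) =
    (k' == k)%:R * T (tg z) (tg x).
  rewrite fpactE (bigD1 x)// basis_fpE eqxx andbT mulrC.
  rewrite big1 => [|h /andP[_ hx]]; first exact: addr0.
  by rewrite basis_fpE (eq_sym x) (negPf hx) andbF mulr0.
rewrite -[LHS]/(fpact CV (basis_fp k) k' (tg z) (tg x) -
  fpact (chi_Cu (mrange V)) (basis_fp k) k' (tg z) (tg x)).
rewrite !E -mulrBr; congr (_ * (_ - _)).
rewrite /chi /mdiag Tagged_eqE eq_sym; case: eqP => _; first by rewrite mulr1.
by rewrite mulr0.
Qed.

(** In the range of V, row z of the displacement is the point mass at h minus that at z, with h in z
    S_n. Its form is 2 - 2 phi_k(z,h), at most 2 psi(z,h)/(k+1). The other rows vanish. *)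
Lemma displacement_bound (M : R) V (CV : Cu d V) k :
  (\forall n \near U, forall x s : G n, s \in S n -> psi x (x * s)%g <= M) ->
  partial_translation d V -> msupp V `<=` generating_entourage S ->
  0 <= M ->
  mean_form (displacement CV k) (displacement CV k) <= 2 * M / k.+1%:R.
Proof.
move=> psiM ptV VE0 M0; apply: mean_form_upper.
near=> n.
have kn : (k < n)%N by near: n; exact: U_infty.
have phi1 : forall z : G n, phi k z z = 1 by near: n; exact: phi_diag.
have psiM' : forall x s : G n, s \in S n -> psi x (x * s)%g <= M by near: n.
rewrite (pform_single kn) => [|k' z x /negPf kk']; last first.
  by rewrite displacementE kk' mul0r.
have Gn0 : 0 < #|G n|%:R :> R by rewrite ltr0n (cardD1 1%g).
rewrite ler_pdivrMl// [leRHS]mulr_natl -sumr_const; apply: ler_sum => z _.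
have bound0 : 0 <= 2 * M / k.+1%:R by rewrite divr_ge0// mulr_ge0.
case: (pt_entry_row (fun=> 0) z ptV) => [[h Vh [V0 _]]|[V0 _]]; last first.
  have nz : ~ mrange V (tg z).
    move=> [[n' y] Vy]; have [nn'|nn'] := eqVneq n n'.
      by subst n'; move: Vy; rewrite V0 => /eqP; rewrite eq_sym oner_eq0.
    move: Vy; rewrite (Cu_off Sgen CV)/=; last exact/eqP.
    by move/eqP; rewrite eq_sym oner_eq0.
  rewrite (_ : rowform _ _ _ = 0)// -(rowform0 k n).
  by congr rowform; apply/funext => x;
    rewrite displacementE V0 asboolF// mul0r subr0 mulr0.
have rz : mrange V (tg z) by exists (tg h).
pose v (x : G n) : R := (x == h)%:R + (-1) * (x == z)%:R.
rewrite (@rowform_real _ _ v) => [|x]; last first.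
  have VE : V (tg z) (tg x) = (x == h)%:R.
    by case: eqP => [->|/eqP/V0 ->//]; exact: Vh.
  by rewrite displacementE eqxx asboolT// VE /v !mul1r mulN1r !natrC -rmorphB.
rewrite /v kernel_shift; last by move=> x y; exact: phiC.
rewrite sum_delta_mul.
rewrite phi_delta !phi1.
have psi_zh : psi z h <= M.
  have /VE0 [n' [g [s [sS E]]]] : msupp V (tg z, tg h).
    by rewrite /msupp/= Vh oner_eq0.
  have zE : tg z = tg g := congr1 fst E.
  have hE : tg h = tg (g * s)%g := congr1 snd E.
  have nn' : n = n' := congr1 tag zE.
  subst n'; move/eqP: zE; rewrite Tagged_eqE => /eqP ->.
  by move/eqP: hE; rewrite Tagged_eqE => /eqP ->; exact: psiM'.
have phi_zh : 1 - k.+1%:R^-1 * M <= phi k z h.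
  apply: le_trans (expR_ge1Dx _); rewrite lerD2l lerN2 ler_wpM2l// invr_ge0//.
have -> : 2 * M / k.+1%:R = (k.+1%:R^-1 * M) *+ 2 by rewrite mulr2n; ring.
move: phi_zh; rewrite sqrrN expr1n mulr1 mulN1r.
move: (k.+1%:R^-1 * M) (phi k z h) => p q pq; lra.
Unshelve. all: by end_near. Qed.

Lemma quotient_norm0 (L : set K) (u : K) : L 0 -> (forall v, L v -> v = 0) ->
  Defs.quotient_norm L u = rnorm u.
Proof.
move=> L0 Lv; rewrite /Defs.quotient_norm (_ : [set _ | _ in _] = [set rnorm u]) ?inf1//.
apply/seteqP; split=> [_ [v /Lv -> <-]|_ ->]; first by rewrite subr0.
by exists 0 => //; rewrite subr0.
Qed.

Lemma oprep_displacement V (CV : Cu d V) k :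
  oprep V (j (basis_fp k)) - oprep (chi R (mrange V)) (j (basis_fp k)) =
  j (displacement CV k).
Proof. by rewrite (oprepE CV) (oprepE (chi_Cu _)) -raddfB. Qed.

End Operators.

(** Without invariant vectors, (T) would move every unit vector by at least c along some translation
    in the generating entourage, whereas the squared displacement of [basis_fp k] is at most
    2M/(k+1). In the mixing hypothesis r precedes n, so the translations have bounded
    propagation. *)
Lemma not_geometric_property_T (M : R) :
  (\forall n \near U, forall x s : G n, s \in S n -> psi x (x * s)%g <= M) ->
  (forall (B : R) (m : nat), exists r : nat, \forall n \near U,
     exists2 g : G n, (wl g <= r)%N & forall x y z : G n,
     (wl ((z * g)^-1 * x)%g <= m)%N -> (wl (z^-1 * y)%g <= m)%N -> B <= psi x y) ->
  ~ geometric_property_T R S.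
Proof.
move=> psiM psi_mix GT.
have [K [j [jE j_dense j_ext]]] := hilbert_completion mean_form.
have [c c0 cP] := GT K _ (oprep_representation j_dense j_ext).
have inv0 u := @oprep_no_invariant K j jE j_dense j_ext psi_mix u.
have qnE u : Defs.quotient_norm (invariant_vectors d (oprep j_ext)) u = rnorm u.
  by apply: quotient_norm0 => // V ptV; rewrite !linear0.
pose M' := `|M|.
have psiM' : \forall n \near U, forall x s : G n, s \in S n -> psi x (x * s)%g <= M'.
  by apply: filterS psiM => n H x s sS; rewrite (le_trans (H x s sS))// ler_norm.
(* The index k is chosen after c, which was given by the representation. *)
have [k kP] : exists k : nat, 2 * M' / k.+1%:R < c ^+ 2.
  exists (Num.truncn (2 * M' / c ^+ 2)).
  rewrite ltr_pdivrMr// [ltRHS]mulrC -ltr_pdivrMr ?exprn_gt0//.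
  exact: truncnS_gt.
have := cP (j (basis_fp k)); rewrite qnE (rnorm_j jE) /psd_norm basis_fp_norm sqrtr1.
move=> /(_ erefl)[V [ptV VE0]].
have CV : Cu d V by case: ptV.
rewrite qnE (oprep_displacement _ CV) (rnorm_j jE) => c_le.
have := displacement_bound CV k psiM' ptV VE0 (normr_ge0 _).
rewrite -sqr_psd_norm; apply/negP; rewrite -ltNge (lt_le_trans kP)//.
by rewrite ler_pXn2r ?nnegrE ?psd_norm_ge0 ?(ltW c0).
Qed.

End Representation.

(** * Fibred coarse embeddings *)

Lemma affine_isometryB (R : realType) (V W : hilbertType R) (f : V -> W) u v :
  affine_isometry f -> rnorm (f u - f v) = rnorm (u - v).
Proof.
move=> [_ [g gn fE]]; rewrite fE [f v]fE opprD addrACA subrr addr0 -raddfB.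
by rewrite /rnorm gn.
Qed.

Lemma ultrafilter_of_decreasing (A : nat -> set nat) :
  (forall m, A m.+1 `<=` A m) -> (forall m, A m !=set0) ->
  exists U : set_system nat, UltraFilter U /\ forall m, U (A m).
Proof.
move=> Adecr A0.
have Ale m n : (m <= n)%N -> A n `<=` A m.
  move=> /subnK <-; elim: (n - m)%N => [//|k IH].
  by rewrite addSn => x /Adecr/IH.
pose F : set_system nat := [set B | exists m, A m `<=` B].
have FF : ProperFilter F.
  split; first by move=> [m Am]; have [x /Am] := A0 m.
  split; first by exists 0%N.
    move=> B B' [m Am] [m' Am']; exists (maxn m m') => x Ax; split.
      by apply: Am; apply: Ale Ax; rewrite leq_maxl.
    by apply: Am'; apply: Ale Ax; rewrite leq_maxr.
  by move=> B B' BB' [m Am]; exists m => x /Am/BB'.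
have [U [UU FU]] := ultraFilterLemma FF.
by exists U; split=> // m; apply: FU; exists m.
Qed.

(** * Kernels pulled back from a fibred coarse embedding *)

Section Fibred.
Variables (R : realType) (G : nat -> finGroupType) (S : forall n, {set G n}).
Hypotheses (Sgen : forall n, <<S n>>%g = [set: G n]%SET)
           (Sfin : exists k, forall n, (#|S n| <= k)%N).
Local Notation wl := (word_len (@Sgen _)).

Variables (Y : nat -> finType) (dY : forall n, Y n -> Y n -> R)
  (f : forall n, G n -> Y n) (ell : forall n, G n -> R) (c : R).
Hypotheses (c0 : 0 <= c) (dY_ge0 : forall n (y y' : Y n), 0 <= dY y y')
  (dY_le : forall n (x y : G n), dY (f x) (f y) <= ell (x^-1 * y)%g + c)
  (dY_ge : forall n (x y : G n), ell (x^-1 * y)%g <= dY (f x) (f y) + c)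
  (ell_le : forall n (x : G n), ell x <= (wl x)%:R)
  (ellV : forall n (x : G n), ell x^-1%g = ell x)
  (ellM : forall n (x y : G n), ell (x * y)%g <= ell x + ell y)
  (ell_unbounded : forall m : nat, exists n (g : G n),
     (m <= wl g)%N /\ ell g = (wl g)%:R).

(** An element g with ell g = wl g is cut after m letters into h and a rest of length at most wl g -
    m. Subadditivity gives ell h >= m while wl h <= m, so h is long for ell yet of word length
    bounded in n. *)
Lemma fibred_ultrafilter : exists U : set_system nat,
  [/\ UltraFilter U, forall m, \forall n \near U, (m <= n)%N &
    forall m : nat, \forall n \near U,
      exists2 g : G n, (wl g <= m)%N & m%:R <= ell g].
Proof.
pose A m := [set n : nat | (m <= n)%N /\
  exists g : G n, (m <= wl g)%N /\ ell g = (wl g)%:R].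
have [||U [UU UA]] := @ultrafilter_of_decreasing A.
- move=> m n [mn [g [mg gE]]]; split; first exact: ltnW.
  by exists g; split=> //; exact: ltnW.
(* The number b exceeds all word lengths in the first m groups, which are finite, so an element of
   length at least b lies in a group of index n >= m. *)
- move=> m; pose b := (m + \sum_(i < m) \sum_(g : G i) wl g).+1.
  have [n [g [bg gE]]] := ell_unbounded b; exists n; split.
    rewrite leqNgt; apply/negP => nm; move: bg; apply/negP; rewrite -ltnNge /b.
    rewrite ltnS (bigD1 (Ordinal nm))//= (bigD1 g)//=.
    by rewrite addnCA -addnA leq_addr.
  exists g; split=> //; apply: leq_trans bg.
  by rewrite /b ltnW// ltnS leq_addr.
exists U; split=> // m; apply: filterS (UA m) => n [mn [g [mg gE]]] //.
have [h [hm hg]] := word_len_split mg.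
exists h => //.
have := ellM h (h^-1 * g)%g; rewrite mulKVg gE.
have := ell_le (h^-1 * g)%g.
have : (wl (h^-1 * g)%g)%:R <= (wl g - m)%:R :> R by rewrite ler_nat.
rewrite natrB//; lra.
Qed.

Lemma FCE_not_geometric_property_T :
  fibred_coarse_embedding dY -> ~ geometric_property_T R S.
Proof.
move=> [H [Hy [s [rhom [rhop [l [t [_ [[rm0 rmle rmoo] [rp0 rple rpoo]] [_ _ loo]
  t_iso [t_rho t_chart]]]]]]]]].
have [U [UU U_infty U_ell]] := fibred_ultrafilter.
have l_large (r : R) : \forall n \near U, r <= l n.
  have [n0 _ n0P] : \forall n \near \oo, r <= l n.
    by move/cvgryPge: loo; exact.
  by apply: filterS (U_infty n0) => n /n0P.
pose D n (x y : G n) :=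
  rnorm (t n (f x) (f x) (s n (f x)) - t n (f x) (f y) (s n (f y))).
have D0 n (x y : G n) : 0 <= D n x y by exact: rnorm_ge0.
(* [D n x y] is measured in the chart at f x. Charts whose balls do not meet are unrelated, so
   averaging is what makes [psi] symmetric everywhere. *)
pose psi n (x y : G n) := (D n x y ^+ 2 + D n y x ^+ 2) / 2.
have ell1 n : ell (1 : G n)%g <= 0.
  by have := ell_le (1 : G n)%g; rewrite word_len1.
have in_ball n (x y : G n) (r : R) : ell (x^-1 * y)%g <= r -> r + c <= l n ->
    cball (@dY n) (f x) (l n) (f y).
  move=> xy rl; rewrite /cball/=; apply: le_trans (dY_le x y) _.
  by apply: le_trans rl; rewrite lerD2r.
have self_ball n (x : G n) : c <= l n -> cball (@dY n) (f x) (l n) (f x).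
  by move=> cl; apply: (@in_ball _ _ _ 0); rewrite ?mulVg ?add0r.
have ellVM n (x y : G n) : ell (x^-1 * y)%g = ell (y^-1 * x)%g.
  by rewrite -ellV invMg invgK.
have D_rho n (x y : G n) (r : R) : ell (x^-1 * y)%g <= r -> r + c <= l n ->
    0 <= r -> rhom (dY (f x) (f y)) <= D n x y <= rhop (dY (f x) (f y)).
  move=> xy rl r0; apply: t_rho; last exact: in_ball xy rl.
  by apply: self_ball; rewrite (le_trans _ rl)// lerDr.
apply: (@not_geometric_property_T R G S Sgen Sfin U psi UU U_infty _ _ _
  (rhop (1 + c) ^+ 2)).
- by move=> n x y; rewrite /psi addrC.
- by move=> n x y; rewrite /psi divr_ge0// addr_ge0// sqr_ge0.
(* Two points of the m-ball about z are at ell-distance at most 2m, so their images lie in the balls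
   about f z and about either image; the transition isometry then allows all distances to be
   measured in the chart at f z. *)
- move=> m; apply: filterS (l_large (m%:R + m%:R + c)) => n ln z.
  exists H, (hilbert_form H), (fun x => t n (f z) (f x) (s n (f x))) => x y zx zy.
  have ellm (x' : G n) : (wl (z^-1 * x')%g <= m)%N -> ell (z^-1 * x')%g <= m%:R.
    by move=> zx'; rewrite (le_trans (ell_le _))// ler_nat.
  have ln' : m%:R + c <= l n by rewrite (le_trans _ ln)// lerD2r lerDl.
  have cl : c <= l n by rewrite (le_trans _ ln')// lerDr.
  have DE x' y' : (wl (z^-1 * x')%g <= m)%N -> (wl (z^-1 * y')%g <= m)%N ->
      D n x' y' = rnorm (t n (f z) (f x') (s n (f x')) - t n (f z) (f y') (s n (f y'))).
    move=> /ellm zx' /ellm zy'.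
    have xy' : ell (x'^-1 * y')%g <= m%:R + m%:R.
      have -> : (x'^-1 * y' = (x'^-1 * z) * (z^-1 * y'))%g by rewrite mulgA mulgK.
      by rewrite (le_trans (ellM _ _))// lerD// ellVM.
    have xx := self_ball n x' cl; have xy := in_ball _ _ _ _ xy' ln.
    have zxb := in_ball _ _ _ _ zx' ln'; have zyb := in_ball _ _ _ _ zy' ln'.
    have [|tau tau_iso tauE] := t_chart n (f z) (f x'); first by exists (f x').
    by rewrite !tauE//; rewrite affine_isometryB.
  rewrite /psi [hilbert_form _ _ _]hilbert_formxx (DE x y)// (DE y x)// rnormB.
  by field.
- have r0 : 0 <= 1 + c by rewrite addr_ge0.
  have rho0 := rp0 _ r0.
  apply: filterS (l_large (1 + c)) => n ln x g gS.
  have ell_g : ell g <= 1.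
    by rewrite (le_trans (ell_le _))// -[1]/(1%:R) ler_nat word_len_gen.
  have Dle x' y' : ell (x'^-1 * y')%g <= 1 -> D n x' y' <= rhop (1 + c).
    move=> xy'; have /andP[_ Dp] := D_rho n x' y' 1 xy' ln ler01.
    apply: le_trans Dp _; apply: rple => //.
    by rewrite (le_trans (dY_le _ _))// lerD2r.
  have D1 : D n x (x * g)%g <= rhop (1 + c) by apply: Dle; rewrite mulKg.
  have D2 : D n (x * g)%g x <= rhop (1 + c) by apply: Dle; rewrite ellVM mulKg.
  rewrite /psi ler_pdivrMr// mulr_natr mulr2n.
  by apply: lerD; rewrite ler_pXn2r ?nnegrE.
- move=> B m.
  (* The extra 1 makes D >= 1, so that D^2 >= D >= |B|. *)
  have [r0 [_ r0P]] : \forall r \near +oo, `|B| + 1 <= rhom r.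
    by move/cvgryPge: rmoo; exact.
  pose r1 := (Num.truncn `|r0|).+1.
  have r1P r : r1%:R <= r -> `|B| + 1 <= rhom r.
    move=> r1r; apply: r0P; rewrite (le_lt_trans (ler_norm _))//.
    by rewrite (lt_le_trans (truncnS_gt _)).
  pose c1 := (Num.truncn c).+1.
  have cc1 : c <= c1%:R by rewrite ltW// truncnS_gt.
  (* Passing from z g to x and from z to y costs 2m, and passing from [ell] to [dY] costs c <= c1; a
     distance of at least r1 remains, where [rhom] exceeds |B| + 1. *)
  have [r rE] : exists r, r = (r1 + (m + m) + c1)%N by eexists.
  exists r.
  near=> n.
  have [g gr rg] : exists2 g : G n, (wl g <= r)%N & r%:R <= ell g.
    by near: n; exact: U_ell.
  have ln : (m + r + m)%:R + c <= l n by near: n; exact: l_large.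
  exists g => // x y z zx zy.
  have zx' : ell ((z * g)^-1 * x)%g <= m%:R by rewrite (le_trans (ell_le _))// ler_nat.
  have zy' : ell (z^-1 * y)%g <= m%:R by rewrite (le_trans (ell_le _))// ler_nat.
  have gr' : ell g <= r%:R by rewrite (le_trans (ell_le _))// ler_nat.
  have xy_le : ell (x^-1 * y)%g <= (m + r + m)%:R.
    have -> : (x^-1 * y = (x^-1 * (z * g)) * g^-1 * (z^-1 * y))%g.
      by rewrite !mulgA !mulgK.
    rewrite !natrD (le_trans (ellM _ _))// lerD// (le_trans (ellM _ _))// lerD//.
      by rewrite ellVM.
    by rewrite ellV.
  have ell_ge : r1%:R + c <= ell (x^-1 * y)%g.
    have : ell g <= m%:R + (ell (x^-1 * y)%g + m%:R).
      have {1}-> : (g = (z^-1 * y) * ((y^-1 * x) * (x^-1 * (z * g))))%g.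
        by rewrite !mulgA !mulgK mulVg mul1g.
      apply: le_trans (ellM _ _) (lerD zy' _).
      by apply: le_trans (ellM _ _) (lerD _ _); rewrite ellVM.
    move: rg cc1; rewrite rE !natrD.
    move: (ell g) (ell _) => eg exy ? ? ?; lra.
  have BD x' y' : ell (x'^-1 * y')%g <= (m + r + m)%:R ->
      r1%:R + c <= ell (x'^-1 * y')%g -> B <= D n x' y' ^+ 2.
    move=> le_xy ge_xy.
    have /andP[Dp _] := D_rho n x' y' _ le_xy ln (ler0n _ _).
    have bD : `|B| + 1 <= D n x' y'.
      apply: le_trans Dp; apply: r1P; rewrite -(lerD2r c).
      exact: le_trans ge_xy (dY_ge _ _).
    have B0 := normr_ge0 B; have BB := ler_norm B.
    have D1 : 1 <= D n x' y' by apply: le_trans bD; rewrite lerDr.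
    apply: le_trans BB _; apply: le_trans (_ : D n x' y' <= _).
      by apply: le_trans bD; rewrite lerDl.
    by rewrite expr2 ler_peMr.
  rewrite /psi ler_pdivlMr// mulr_natr mulr2n.
  by apply: lerD; apply: BD => //; rewrite ellVM.
Unshelve. all: by end_near. Qed.

End Fibred.

(** * Length in the quotient group *)

Section QuotientLength.
Variables (R : realType) (Gamma Q : finGroupType) (S : {set Gamma}).
Variables (p : {morphism [set: Gamma]%SET >-> Q}).
Hypotheses (Sgen : <<S>>%g = [set: Gamma]%SET) (Ssym : (S^-1)%g = S).
Local Notation wl := (word_len Sgen).

Let pM x y : p (x * y)%g = (p x * p y)%g.
Proof. by rewrite morphM ?inE. Qed.

Let pV x : p (x^-1)%g = (p x)^-1%g.
Proof. by rewrite morphV ?inE. Qed.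

Lemma quotient_len_ex (g : Gamma) :
  exists k, [exists h, (p h == p g) && (wl h == k)].
Proof. by exists (wl g); apply/existsP; exists g; rewrite !eqxx. Qed.

(** Kept as a function on [Gamma], constant on the fibres of [p], so that it can serve as [ell]. *)
Definition quotient_len g : nat := ex_minn (quotient_len_ex g).

Lemma quotient_len_rep g : exists2 h, p h = p g & wl h = quotient_len g.
Proof.
rewrite /quotient_len; case: ex_minnP => k /existsP[h /andP[/eqP hg /eqP <-]] _.
by exists h.
Qed.

Lemma quotient_len_le g h : p h = p g -> (quotient_len g <= wl h)%N.
Proof.
rewrite /quotient_len; case: ex_minnP => k _ kmin hg; apply: kmin.
by apply/existsP; exists h; rewrite hg !eqxx.
Qed.

Lemma quotient_lenM g h :
  (quotient_len (g * h)%g <= quotient_len g + quotient_len h)%N.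
Proof.
have [x xg <-] := quotient_len_rep g; have [y yh <-] := quotient_len_rep h.
by rewrite (leq_trans _ (word_lenM _ _ _))// quotient_len_le// !pM xg yh.
Qed.

Lemma quotient_lenV g : quotient_len g^-1%g = quotient_len g.
Proof.
suff H x : (quotient_len x^-1%g <= quotient_len x)%N.
  by apply/eqP; rewrite eqn_leq H/= -{1}[g]invgK H.
have [y yx <-] := quotient_len_rep x.
by rewrite -(word_lenV Sgen Ssym) quotient_len_le// !pV yx.
Qed.

(** The infimum runs over lifts of both points. By left invariance only x'^-1 y' matters; it ranges
    over the coset of x^-1 y already when x is kept fixed. *)
Lemma quotient_distE x y :
  quotient_dist p (word_dist R S) (p x) (p y) = (quotient_len (x^-1 * y)%g)%:R.
Proof.
apply/le_anti/andP; split.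
  have [h hp hE] := quotient_len_rep (x^-1 * y)%g.
  apply: ge_inf.
    exists 0 => _ [x' [y' [_ _ ->]]].
    by rewrite /word_dist (word_lengthE _ Sgen).
  exists x, (x * h)%g; split=> //; first by rewrite pM hp !pM pV mulKVg.
  by rewrite /word_dist (word_lengthE _ Sgen) mulKg hE.
apply: lb_le_inf; first by exists (word_dist R S x y), x, y.
move=> _ [x' [y' [x'x y'y ->]]]; rewrite /word_dist (word_lengthE _ Sgen) ler_nat.
by rewrite quotient_len_le// !pM !pV x'x y'y.
Qed.

End QuotientLength.

(** * Unbounded quotients, or dense normal subgroups *)

Lemma unbounded_seqP (R : realType) (Y : nat -> Type)
    (d : forall n, Y n -> Y n -> R) :
  unbounded_seq d -> forall M : R, exists n x y, M < d n x y.
Proof.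
move=> dY M; apply: contrapT => nM.
have : (ereal_sup [set diam (d n) | n in [set: nat]] <= M%:E)%E.
  apply: ge_ereal_sup => _ [n _ <-]; apply: ge_ereal_sup => _ [x [y ->]].
  rewrite lee_fin leNgt; apply/negP => Mxy; apply: nM.
  by exists n, x, y.
by rewrite dY leye_eq.
Qed.

Theorem theorem1p6 (R : realType) (N Gamma Q : nat -> finGroupType)
    (iota : forall n, {morphism [set: N n]%SET >-> Gamma n})
    (p : forall n, {morphism [set: Gamma n]%SET >-> Q n})
    (S : forall n, {set Gamma n}) :
  (forall n, group_extension (iota n) (p n)) ->
  uniformly_finite_generating S ->
  FCE_by_FCE R iota p S ->
  unbounded_seq (fun n => word_dist R (S n)) ->
  ~ geometric_property_T R S.
Proof.
move=> ext [Ssym Sgen Sfin] [fceN fceQ] unb.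
have wd n x y : word_dist R (S n) x y = (word_len (Sgen n) (x^-1 * y)%g)%:R.
  by rewrite /word_dist (word_lengthE _ (Sgen n)).
have [[D QD]|nQ] := pselect (exists D : nat, forall n (g : Gamma n),
    (quotient_len (p n) (Sgen n) g <= D)%N); last first.
  apply: (@FCE_not_geometric_property_T R Gamma S Sgen Sfin Q _ (fun n => p n)
    (fun n g => (quotient_len (p n) (Sgen n) g)%:R) 0 _ _ _ _ _ _ _ _ fceQ) => //.
  - move=> n q q'; have [_ _ psurj] := ext n.
    have pre (r : Q n) : exists x, p n x = r.
      have : r \in (p n @* [set: Gamma n]%SET)%g by rewrite psurj finset.in_setT.
      by case/morphimP => x _ _ ->; exists x.
    have [x <-] := pre q; have [y <-] := pre q'.
    by rewrite (quotient_distE _ _ (Sgen n)).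
  - by move=> n x y; rewrite addr0 (quotient_distE _ _ (Sgen n)).
  - by move=> n x y; rewrite addr0 (quotient_distE _ _ (Sgen n)).
  - by move=> n x; rewrite ler_nat quotient_len_le.
  - by move=> n x; rewrite quotient_lenV.
  - by move=> n x y; rewrite -natrD ler_nat quotient_lenM.
  (* A shortest representative h of its coset has quotient length equal to its word length, as
     [ell_unbounded] requires. *)
  - move=> m; apply: contrapT => nm; apply: nQ; exists m => n g.
    rewrite leqNgt; apply/negP => mg; apply: nm; exists n.
    have [h hg hE] := quotient_len_rep (p n) (Sgen n) g; exists h.
    split; first by rewrite hE ltnW.
    have [h' h'h h'E] := quotient_len_rep (p n) (Sgen n) h.
    congr (_%:R); apply/eqP; rewrite eqn_leq quotient_len_le//= -h'E hE.
    by rewrite quotient_len_le// h'h.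
have f_ex n : exists fn : Gamma n -> N n, forall g,
    (word_len (Sgen n) ((iota n (fn g))^-1 * g)%g <= D)%N.
  suff /choice[fn fnP] : forall g, exists a,
      (word_len (Sgen n) ((iota n a)^-1 * g)%g <= D)%N by exists fn.
  (* With h the shortest element of the coset of g, the kernel element g h^-1 lies at distance wl h
     <= D from g. *)
  move=> g; have [_ kerE _] := ext n.
  have [h hg hE] := quotient_len_rep (p n) (Sgen n) g.
  have : (g * h^-1)%g \in ('ker (p n))%g.
    apply/kerP; first exact: finset.in_setT.
    by rewrite morphM ?finset.in_setT// morphV ?finset.in_setT// hg mulgV.
  rewrite -kerE => /morphimP[a _ _ aE]; exists a.
  by rewrite -aE invMg invgK mulgKV hE.
pose f n := projT1 (cid (f_ex n)).
have fP n g : (word_len (Sgen n) ((iota n (f n g))^-1 * g)%g <= D)%N.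
  exact: projT2 (cid (f_ex n)) g.
have tri n (x y z : Gamma n) : (word_len (Sgen n) (x^-1 * z)%g <=
    word_len (Sgen n) (x^-1 * y)%g + word_len (Sgen n) (y^-1 * z)%g)%N.
  have -> : (x^-1 * z = (x^-1 * y) * (y^-1 * z))%g by rewrite mulgA mulgK.
  exact: word_lenM.
have wVM n (x y : Gamma n) :
    word_len (Sgen n) (x^-1 * y)%g = word_len (Sgen n) (y^-1 * x)%g.
  by rewrite -(word_lenV (Sgen n) (Ssym n)) invMg invgK.
(* The map f moves each of two points by at most D, so distances change by at most D + D. *)
apply: (@FCE_not_geometric_property_T R Gamma S Sgen Sfin N _ f
  (fun n g => (word_len (Sgen n) g)%:R) (D + D)%:R _ _ _ _ _ _ _ _ fceN) => //.
- by move=> n a a'; rewrite /subspace_dist wd.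
- move=> n x y; rewrite /subspace_dist wd -natrD ler_nat.
  have h1 := tri n (iota n (f n x)) x (iota n (f n y)).
  have h2 := tri n x y (iota n (f n y)); rewrite (wVM n y) in h2.
  have := fP n x; have := fP n y; lia.
- move=> n x y; rewrite /subspace_dist wd -natrD ler_nat.
  have h1 := tri n x (iota n (f n x)) y.
  rewrite (wVM n x (iota n (f n x))) in h1.
  have h2 := tri n (iota n (f n x)) (iota n (f n y)) y.
  have := fP n x; have := fP n y; lia.
- by move=> n x; rewrite word_lenV.
- by move=> n x y; rewrite -natrD ler_nat word_lenM.
- move=> m; have [n [x [y]]] := unbounded_seqP unb m%:R.
  by rewrite wd ltr_nat => /ltnW mxy; exists n, (x^-1 * y)%g.
Qed.
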